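(* The set of all weighted right multi-Toeplitz operators on $\mathcal E\otimes F^2(H_n)$ coincides with $$\overline{\boldsymbol{\mathcal A}_{\mathcal E}({\bf D}_f^m)^*+\boldsymbol{\mathcal A}_{\mathcal E}({\bf D}_f^m)}^{\,WOT}=\overline{\boldsymbol{\mathcal A}_{\mathcal E}({\bf D}_f^m)^*+\boldsymbol{\mathcal A}_{\mathcal E}({\bf D}_f^m)}^{\,SOT},$$ where $\boldsymbol{\mathcal A}_{\mathcal E}({\bf D}_f^m):=B(\mathcal E)\otimes_{min}\mathcal A({\bf D}_f^m)$ and $\mathcal A({\bf D}_f^m)$ is the noncommutative domain algebra.
   Context: Fix integers $n,m\ge1$ and a separable Hilbert space $\mathcal E$. $\mathbb F_n^+$ is the free monoid on generators $g_1,\dots,g_n$ with identity $g_0$; $|\alpha|$ is the word length ($|g_0|=0$). $f=\sum_{\alpha}a_\alpha Z_\alpha$ is a fixed positive regular free holomorphic function: a formal power series in noncommuting indeterminates $Z_1,\dots,Z_n$ (with $Z_\alpha=Z_{i_1}\cdots Z_{i_k}$ for $\alpha=g_{i_1}\cdots g_{i_k}$) such that $a_\alpha\ge0$, $a_{g_0}=0$, $a_{g_i}>0$ for $1\le i\le n$, and $\limsup_{k}\big(\sum_{|\alpha|=k}|a_\alpha|^2\big)^{1/2k}<\infty$. Put $b^{(m)}_{g_0}:=1$ and, for $|\alpha|\ge1$, $$b^{(m)}_\alpha:=\sum_{j=1}^{|\alpha|}\ \sum_{\gamma_1\cdots\gamma_j=\alpha,\ |\gamma_i|\ge1}a_{\gamma_1}\cdots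 a_{\gamma_j}\binom{j+m-1}{m-1}.$$ $F^2(H_n)$ (full Fock space) is the Hilbert space with orthonormal basis $\{e_\alpha\}_{\alpha\in\mathbb F_n^+}$, $e_{g_0}=1$. The weighted left creation operators $W_i\in B(F^2(H_n))$ are $W_ie_\alpha=\sqrt{b^{(m)}_\alpha/b^{(m)}_{g_i\alpha}}\,e_{g_i\alpha}$. The domain algebra $\mathcal A({\bf D}_f^m)$ is the norm closure of the polynomials in $W_1,\dots,W_n$ and the identity. $\otimes_{min}$ is the spatial tensor product (norm closure of the algebraic tensor product in $B(\mathcal E\otimes F^2(H_n))$). WOT/SOT denote weak/strong operator topologies. For $\omega,\gamma\in\mathbb F_n^+$ write $\omega\ge_r\gamma$ if $\omega=\sigma\gamma$ for some $\sigma\in\mathbb F_n^+$, and $\omega>_r\gamma$ if moreover $\sigma\ne g_0$; $\omega,\gamma$ are comparable if $\omega\ge_r\gamma$ or $\gamma>_r\omega$. For comparable $\omega,\gamma$ put $\lambda_{\omega,\gamma}:=\sqrt{b^{(m)}_\omega/b^{(m)}_\gamma}$ if $\omega\ge_r\gamma$ and $\lambda_{\omega,\gamma}:=\sqrt{b^{(m)}_\gamma/b^{(m)}_\omega}$ if $\gamma>_r\omega$. For $T\in B(\mathcal E\otimes F^2(H_n))$ let $C_{\omega,\gamma}\in B(\mathcal E)$ be given by $\langle C_{\omega,\gamma}x,y\rangle=\langle T(x\otimes e_\gamma),y\otimes e_\omega\rangle$. $T$ is a weighted right multi-Toeplitz operator if $\lambda_{\omega g_i,\gamma g_i}C_{\omega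 g_i,\gamma g_i}=\lambda_{\omega,\gamma}C_{\omega,\gamma}$ for all $i\in\{1,\dots,n\}$ and all comparable $\omega,\gamma$, and $C_{\alpha,\beta}=0$ whenever $\alpha,\beta$ are not comparable. *)

(* Defs.v *)
From HB Require Import structures.
From mathcomp Require Import all_boot all_order all_algebra.
From mathcomp Require Import complex.
From mathcomp Require Import all_classical all_reals all_analysis.

Set Implicit Arguments.
Unset Strict Implicit.
Unset Printing Implicit Defensive.

Import Order.TTheory GRing.Theory Num.Theory.
Import numFieldNormedType.Exports.

Local Open Scope classical_set_scope.
Local Open Scope ring_scope.
Local Open Scope complex_scope.

(** * Hilbert spaces and bounded operators *)

(* The inner product is linear in its first argument and conjugate-linear in
   the second one.  Norms over [R[i]] take their values in [R[i]]. *)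
Record hilbertSpace (R : realType) := HilbertSpace {
  hilbert_sort :> completeNormedModType R[i];
  dotp : {dot hilbert_sort for (@Num.conj R[i])};
  dotpE : forall x : hilbert_sort, `|x| ^+ 2 = dotp x x }.

Definition separable (T : topologicalType) :=
  exists2 D : set T, countable D & dense D.

Section Operators.
Variable R : realType.
Implicit Types H K E F : hilbertSpace R.

Definition bounded_op H K : set (H -> K) :=
  [set T | linear T /\ exists M : R[i], forall x, `|T x| <= M * `|x|].

(* [ {T in B(H,K) | for all eps > 0 there is S in A with ||T - S|| <= eps} ]:
   the closure of [A] in [B(H,K)] for the operator norm. *)
Definition norm_closure H K (A : set (H -> K)) : set (H -> K) :=
  [set T | bounded_op T /\ forall eps : R, 0 < eps ->
     exists2 S, A S & forall x, `|T x - S x| <= eps%:C * `|x|].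

(* The SOT on [B(H)] is the topology of pointwise convergence in norm, the WOT
   is the coarsest one for which all the maps [T |-> <T x, y>] are continuous.
   Both are put on all functions [H -> H], and closures are intersected with
   [B(H)]. *)
Definition sot_closure H (A : set (H -> H)) : set (H -> H) :=
  @bounded_op H H `&` closure (A : set {ptws H -> H}).

Definition matrix_coefs H (T : H -> H) : {ptws (H * H)%type -> R[i]^o} :=
  fun xy => dotp H (T xy.1) xy.2.

Definition wot_closure H (A : set (H -> H)) : set (H -> H) :=
  @bounded_op H H `&` closure (A : set (initial_topology (@matrix_coefs H))).

Definition adjoints H (A : set (H -> H)) : set (H -> H) :=
  [set S | bounded_op S /\
     exists2 T, A T & forall x y, dotp H (T x) y = dotp H x (S y)].

Definition op_sum H (A B : set (H -> H)) : set (H -> H) :=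
  [set T | exists S1 S2, [/\ A S1, B S2 & T = S1 \+ S2]].

Definition orthonormal_basis (I : eqType) H (e : I -> H) :=
  (forall i j, dotp H (e i) (e j) = (i == j)%:R) /\
  dense [set x : H | exists s : seq (R[i] * I),
                       x = \sum_(p <- s) p.1 *: e p.2].

(* [K], together with [tens x u] written x (x) u, is the Hilbert space tensor
   product of [E] and [F]; this determines [K] up to unitary equivalence. *)
Definition hilbert_tensor E F K (tens : {bilinear E -> F -> K}) :=
  (forall x y u v,
     dotp K (tens x u) (tens y v) = dotp E x y * dotp F u v) /\
  dense [set z : K | exists s : seq (E * F),
                       z = \sum_(p <- s) tens p.1 p.2].

(* The operators [sum_j X_j (x) Y_j] with [X_j] in [A] and [Y_j] in [B]: such
   an operator is the only bounded one with these values on elementary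
   tensors. *)
Definition algebraic_tensor E F K (tens : {bilinear E -> F -> K})
    (A : set (E -> E)) (B : set (F -> F)) : set (K -> K) :=
  [set T | bounded_op T /\ exists (k : nat) (X : 'I_k -> E -> E) (Y : 'I_k -> F -> F),
     [/\ forall j, A (X j), forall j, B (Y j)
       & forall x u, T (tens x u) = \sum_(j < k) tens (X j x) (Y j u)]].

Definition spatial_tensor E F K (tens : {bilinear E -> F -> K})
    (A : set (E -> E)) (B : set (F -> F)) : set (K -> K) :=
  norm_closure (algebraic_tensor tens A B).

End Operators.

(** * Free holomorphic functions and the associated weights *)

(* The free monoid on [n] generators is [seq 'I_n]: the identity is [[::]],
   the product is [++], the length is [size]. *)
Notation word n := (seq 'I_n).

Section Weights.
Variables (R : realType) (n : nat).
Implicit Types (a : word n -> R) (m : nat) (w v : word n).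

Definition positive_regular_free_holomorphic a :=
  [/\ forall w, 0 <= a w, a [::] = 0, forall i, 0 < a [:: i]
    & (limn_esup (fun k : nat =>
         ((\sum_(w : k.-tuple 'I_n) `|a w| ^+ 2) `^ (2 * k)%:R^-1)%:E)
        < +oo)%E].

(* For the empty word the formula would give the empty sum, whence the case
   distinction. The factors of a factorization of [w] have length at most
   [size w], so that they range over a finite type. *)
Definition weight m a w : R :=
  if w is [::] then 1 else
  \sum_(1 <= j < (size w).+1)
    \sum_(g : j.-tuple ((size w).-bseq 'I_n) |
            (flatten [seq bseqval x | x <- g] == w)
            && [forall i : 'I_j, (1 <= size (tnth g i))%N])
      (\prod_(i < j) a (tnth g i)) * ('C(j + m - 1, m - 1))%:R.

(* [w >=_r v] is [suffix v w]. *)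
Definition comparable_r w v := suffix v w || suffix w v.

Definition lambda m a w v : R :=
  if suffix v w then Num.sqrt (weight m a w / weight m a v)
  else Num.sqrt (weight m a v / weight m a w).

End Weights.

(** * The domain algebra and weighted multi-Toeplitz operators *)

Section DomainAlgebra.
Variables (R : realType) (n m : nat) (a : word n -> R).
Variables (F : hilbertSpace R) (e : word n -> F).

(* [W_i] is the unique bounded operator with the prescribed values on the
   basis [e]. *)
Definition weighted_creation (i : 'I_n) : F -> F :=
  xget (fun=> 0) [set W | bounded_op W /\ forall w,
    W (e w) = (Num.sqrt (weight m a w / weight m a (i :: w)))%:C
              *: e (i :: w)].

Definition creation_word (w : word n) : F -> F :=
  foldr (fun i T => weighted_creation i \o T) id w.

Definition creation_polynomials : set (F -> F) :=
  [set T | exists s : seq (R[i] * word n),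
     T = fun x => \sum_(p <- s) p.1 *: creation_word p.2 x].

Definition domain_algebra : set (F -> F) := norm_closure creation_polynomials.

Variables (E K : hilbertSpace R) (tens : {bilinear E -> F -> K}).

Definition domain_algebra_tensor : set (K -> K) :=
  spatial_tensor tens (@bounded_op R E E) domain_algebra.

(* [C_{w,v}]; its existence for bounded [T] is Riesz representation. *)
Definition op_coef (T : K -> K) (w v : word n) : E -> E :=
  xget (fun=> 0) [set C | bounded_op C /\ forall x y,
    dotp E (C x) y = dotp K (T (tens x (e v))) (tens y (e w))].

Definition weighted_right_multi_toeplitz : set (K -> K) :=
  [set T | [/\ bounded_op T,
    forall i w v, comparable_r w v -> forall x,
      (lambda m a (rcons w i) (rcons v i))%:C
        *: op_coef T (rcons w i) (rcons v i) x
      = (lambda m a w v)%:C *: op_coef T w v x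
  & forall w v, ~~ comparable_r w v -> forall x, op_coef T w v x = 0]].

End DomainAlgebra.

(* Main.v *)
(* A multi-Toeplitz operator T is determined by the block entries of its first
   column and first row, which are its Fourier coefficients along the weighted
   shifts W_s and their adjoints.  Its Fejer means, obtained by multiplying the
   entry (w, v) by (1 - | |w| - |v| | / k)_+, are therefore sums of a finite sum
   of X (x) W_s and of the adjoint of such a sum.  They are averages of
   compressions of T to windows of k consecutive degrees, so their norms do not
   exceed that of T, and they converge strongly to T.  Conversely the Toeplitz
   relations are linear conditions on pairs of matrix coefficients; they hold
   for X (x) W_s and are stable under sums, adjoints, and norm and WOT limits. *)

Require Import Defs.
From HB Require Import structures.
From mathcomp Require Import all_boot all_order all_algebra.
From mathcomp Require Import complex ring lra zify.
From mathcomp Require Import all_classical all_reals all_analysis.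

Set Implicit Arguments.
Unset Strict Implicit.
Unset Printing Implicit Defensive.

Import Order.TTheory GRing.Theory Num.Theory.
Import numFieldNormedType.Exports.

Local Open Scope classical_set_scope.
Local Open Scope ring_scope.
Local Open Scope complex_scope.

(** * Hilbert spaces *)

(** Partial sums of the Fourier expansion of [T] come without a uniform norm bound, so their
    convergence on elementary vectors would not extend to all of [K]; the Fejer factors are chosen
    for such a bound. It comes from counting: degrees [i] and [j] share exactly [(k - |i - j|)_+]
    windows and each degree lies in [k] of them, so summing a quadratic estimate for [T] over all
    windows and dividing by [k] gives back the same estimate. The means are finite sums because the
    factor vanishes once the lengths differ by [k] or more and there are finitely many words of each
    length. The shifts [W_i] are bounded thanks to the inequality [a_i * b_w <= b_(i w)] between the
    weights. *)

Section RealNorm.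
Variable R : realType.
Implicit Types H K : hilbertSpace R.

(** Norms live in [R[i]]. Passing to real parts loses nothing and makes all estimates statements
    about real numbers, within reach of [lra] and [nra]. *)
Definition rnorm H (x : H) : R := complex.Re `|x|.
Definition rdot H (x y : H) : R := complex.Re (dotp H x y).

Lemma rnormE H (x : H) : `|x| = (rnorm x)%:C.
Proof. by rewrite /rnorm RRe_real // ger0_real. Qed.

Lemma rnorm_ge0 H (x : H) : 0 <= rnorm x.
Proof. by rewrite -ler0c -rnormE. Qed.

Lemma rnorm_eq0 H (x : H) : rnorm x = 0 -> x = 0.
Proof. by move=> x0; apply/eqP; rewrite -normr_eq0 rnormE x0. Qed.

Lemma rnorm0 H : rnorm (0 : H) = 0.
Proof. by rewrite /rnorm normr0. Qed.

Lemma rnormN H (x : H) : rnorm (- x) = rnorm x.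
Proof. by rewrite /rnorm normrN. Qed.

Lemma rnormD H (x y : H) : rnorm (x + y) <= rnorm x + rnorm y.
Proof. by rewrite -lecR rmorphD /= -!rnormE ler_normD. Qed.

Lemma rnormB H (x y : H) : rnorm (x - y) <= rnorm x + rnorm y.
Proof. by rewrite -(rnormN y) rnormD. Qed.

Lemma rnorm_distC H (x y : H) : rnorm (x - y) = rnorm (y - x).
Proof. by rewrite -rnormN opprB. Qed.

Lemma rnorm_distD H (z x y : H) :
  rnorm (x - y) <= rnorm (x - z) + rnorm (z - y).
Proof. by rewrite (le_trans _ (rnormD _ _)) // addrA subrK. Qed.

Lemma rnormZ H (c : R[i]) (x : H) : rnorm (c *: x) = complex.Re `|c| * rnorm x.
Proof.
have -> : rnorm (c *: x) = complex.Re (`|c| * `|x|) by rewrite /rnorm normrZ.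
rewrite rnormE; case: `|c| => p q; rewrite mulrC /=.
by rewrite mul0r subr0 mulrC.
Qed.

Lemma rnorm_le H K (x : H) (y : K) (M : R) :
  (`|x| <= M%:C * `|y|) = (rnorm x <= M * rnorm y).
Proof. by rewrite !rnormE -rmorphM lecR. Qed.

Lemma dotDl H (x y z : H) : dotp H (x + y) z = dotp H x z + dotp H y z.
Proof. exact: linearDl. Qed.

Lemma dotDr H (x y z : H) : dotp H x (y + z) = dotp H x y + dotp H x z.
Proof. exact: linearDr. Qed.

Lemma dotZl H c (x y : H) : dotp H (c *: x) y = c * dotp H x y.
Proof. exact: linearZl_LR. Qed.

Lemma dotZr H c (x y : H) : dotp H x (c *: y) = Num.conj c * dotp H x y.
Proof. exact: linearZr_LR. Qed.

Lemma dotNl H (x y : H) : dotp H (- x) y = - dotp H x y.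
Proof. exact: linearNl. Qed.

Lemma dot0l H (x : H) : dotp H 0 x = 0.
Proof. exact: linear0l. Qed.

Lemma dot0r H (x : H) : dotp H x 0 = 0.
Proof. exact: linear0r. Qed.

Lemma dotC H (x y : H) : dotp H x y = Num.conj (dotp H y x).
Proof. by rewrite [LHS]hermC expr0 mul1r. Qed.

Lemma dot_suml H (I : Type) (s : seq I) (P : pred I) (f : I -> H) y :
  dotp H (\sum_(i <- s | P i) f i) y = \sum_(i <- s | P i) dotp H (f i) y.
Proof. exact: linear_sumlz. Qed.

Lemma Re_conj (z : R[i]) : complex.Re (Num.conj z) = complex.Re z.
Proof. by case: z. Qed.

Lemma rdotDl H (x y z : H) : rdot (x + y) z = rdot x z + rdot y z.
Proof. by rewrite /rdot dotDl; case: (dotp H x z) (dotp H y z) => ? ? []. Qed.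

Lemma rdotC H (x y : H) : rdot x y = rdot y x.
Proof. by rewrite /rdot dotC Re_conj. Qed.

Lemma rdotDr H (x y z : H) : rdot x (y + z) = rdot x y + rdot x z.
Proof. by rewrite rdotC rdotDl !(rdotC x). Qed.

Lemma rdotNl H (x y : H) : rdot (- x) y = - rdot x y.
Proof. by rewrite /rdot dotNl; case: (dotp H x y). Qed.

Lemma rdotNr H (x y : H) : rdot x (- y) = - rdot x y.
Proof. by rewrite rdotC rdotNl rdotC. Qed.

Lemma rdotZl H (t : R) (x y : H) : rdot (t%:C *: x) y = t * rdot x y.
Proof.
by rewrite /rdot dotZl; case: (dotp H x y) => p q /=; rewrite mul0r subr0.
Qed.

Lemma rdotZr H (t : R) (x y : H) : rdot x (t%:C *: y) = t * rdot x y.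
Proof. by rewrite rdotC rdotZl rdotC. Qed.

Lemma rdot0l H (x : H) : rdot 0 x = 0.
Proof. by rewrite /rdot dot0l. Qed.

Lemma rdot0r H (x : H) : rdot x 0 = 0.
Proof. by rewrite /rdot dot0r. Qed.

Lemma rdot_suml H (I : Type) (s : seq I) (P : pred I) (f : I -> H) y :
  rdot (\sum_(i <- s | P i) f i) y = \sum_(i <- s | P i) rdot (f i) y.
Proof.
elim/big_rec2 : _ => [|i p q _ <-]; first by rewrite rdot0l.
by rewrite rdotDl.
Qed.

Lemma rdot_sumr H (I : Type) (s : seq I) (P : pred I) (f : I -> H) y :
  rdot y (\sum_(i <- s | P i) f i) = \sum_(i <- s | P i) rdot y (f i).
Proof. by rewrite rdotC rdot_suml; apply: eq_bigr => i _; rewrite rdotC. Qed.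

Lemma rnorm_sqr H (x : H) : rnorm x ^+ 2 = rdot x x.
Proof.
by apply: complexI; rewrite /rdot -dotpE rnormE -rmorphXn.
Qed.

Lemma rnormZr H (t : R) (x : H) : rnorm (t%:C *: x) = `|t| * rnorm x.
Proof. by rewrite rnormZ normc_def /= expr0n addr0 sqrtr_sqr. Qed.

(** The choice [c = 1] gives the real parts and [c = 'i] the imaginary parts up to sign; this
    transfers real identities to complex ones. *)
Lemma rdot_dot H K (x y : H) (z t : K) :
  (forall c : R[i], rdot (c *: x) y = rdot (c *: z) t) ->
  dotp H x y = dotp K z t.
Proof.
move=> h; have := h 1; have := h 'i; rewrite /rdot !dotZl !mul1r.
case: (dotp H x y) (dotp K z t) => p q [p' q'] /=.
by rewrite !mul0r !mul1r !sub0r => /oppr_inj -> ->.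
Qed.

Lemma rdot_eq H (x y : H) : (forall z, rdot x z = rdot y z) -> x = y.
Proof.
move=> h; apply/eqP; rewrite -subr_eq0; apply/eqP/rnorm_eq0/eqP.
by rewrite -sqrf_eq0 rnorm_sqr rdotDl rdotNl h subrr.
Qed.

Lemma dot_eq H (x y : H) : (forall z, dotp H x z = dotp H y z) -> x = y.
Proof. by move=> h; apply: rdot_eq => z; rewrite /rdot h. Qed.

Lemma rnorm_sqrD H (x y : H) :
  rnorm (x + y) ^+ 2 = rnorm x ^+ 2 + 2 * rdot x y + rnorm y ^+ 2.
Proof. by rewrite !rnorm_sqr rdotDl !rdotDr (rdotC y x); ring. Qed.

Lemma rnorm_sqrB H (x y : H) :
  rnorm (x - y) ^+ 2 = rnorm x ^+ 2 - 2 * rdot x y + rnorm y ^+ 2.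
Proof. by rewrite rnorm_sqrD rnormN rdotNr; ring. Qed.

Lemma rdot_le H (x y : H) : rdot x y <= rnorm x * rnorm y.
Proof.
have [/rnorm_eq0 ->|x0] := eqVneq (rnorm x) 0; first by rewrite rdot0l rnorm0 mul0r.
have [/rnorm_eq0 ->|y0] := eqVneq (rnorm y) 0; first by rewrite rdot0r rnorm0 mulr0.
have x1 : 0 < rnorm x by rewrite lt_neqAle eq_sym x0 rnorm_ge0.
have y1 : 0 < rnorm y by rewrite lt_neqAle eq_sym y0 rnorm_ge0.
(* Both vectors are scaled to the same norm, so the expanded square is Cauchy-Schwarz up to a
   positive factor. *)
have := sqr_ge0 (rnorm ((rnorm y)%:C *: x - (rnorm x)%:C *: y)).
rewrite rnorm_sqrB rdotZl rdotZr !rnormZr !ger0_norm ?rnorm_ge0 // => h.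
rewrite -(ler_pM2l (mulr_gt0 x1 y1)); nra.
Qed.

Lemma dot_le H (x y : H) : `|dotp H x y| <= (rnorm x * rnorm y)%:C.
Proof.
set z := dotp H x y; have [z0|z0] := eqVneq z 0.
  by rewrite z0 normr0 ler0c mulr_ge0 // rnorm_ge0.
have zE : (complex.Re `|z|)%:C = `|z| by rewrite RRe_real // ger0_real.
have z1 : 0 < complex.Re `|z| by rewrite -ltcR zE normr_gt0.
(* Multiplying [x] by the conjugate of [z] turns the inner product into the real number [|z|^2]. *)
have := rdot_le (Num.conj z *: x) y.
rewrite rnormZ norm_conjC /rdot dotZl -/z mulrC -normCK -zE -rmorphXn lecR /=.
by rewrite -mulrA expr2 ler_pM2l.
Qed.

End RealNorm.

(** * Completeness and density in terms of the real norm *)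

Section Complete.
Variable R : realType.
Implicit Types H K : hilbertSpace R.

Lemma gt0_real_complex (c : R[i]) : 0 < c -> exists2 r : R, 0 < r & c = r%:C.
Proof.
case: c => p q; rewrite ltcE /= => /andP[/eqP -> p0]; first by exists p.
Qed.

Lemma invS_le_eps (eps : R) : 0 < eps ->
  exists N, forall i, (N <= i)%N -> i.+1%:R^-1 <= eps.
Proof.
move=> eps0; exists (Num.truncn eps^-1) => i hi.
rewrite -[leRHS]invrK lef_pV2 ?posrE ?invr_gt0 //.
by apply/ltW/(lt_le_trans (truncnS_gt _)); rewrite ler_nat.
Qed.

Lemma rnorm_complete H (u : nat -> H) :
  (forall eps, 0 < eps -> exists N, forall i j, (N <= i)%N -> (N <= j)%N ->
     rnorm (u i - u j) <= eps) ->
  exists l, forall eps, 0 < eps -> exists N, forall i, (N <= i)%N ->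
     rnorm (u i - l) <= eps.
Proof.
move=> cu.
have /cauchy_cvgP cvu : cauchy (u @ \oo).
  apply/cauchyP => _ /gt0_real_complex[r r0 ->].
  have [|N hN] := cu (r / 2); first by rewrite divr_gt0.
  exists (u N); exists N => // i /= Ni; rewrite -ball_normE /= rnormE ltcR.
  by apply: le_lt_trans (hN N i _ _) _ => //; lra.
exists (lim (u @ \oo)) => eps eps0.
have /cvgrPdist_le /(_ eps%:C) : u @ \oo --> lim (u @ \oo) by [].
rewrite ltcR => /(_ eps0) [N _ hN]; exists N => i Ni.
by rewrite -lecR -rnormE distrC; exact: hN.
Qed.

Definition rdense H (D : set H) :=
  forall z eps, 0 < eps -> exists2 d, D d & rnorm (z - d) <= eps.

Lemma dense_rdense H (D : set H) : dense D -> rdense D.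
Proof.
move=> dD z eps eps0; have [||d []] := dD (ball z eps%:C).
- by exists z; apply: ballxx; rewrite ltcR.
- by apply: ball_open; rewrite ltcR.
by rewrite -ball_normE /= rnormE ltcR => /ltW; exists d.
Qed.

End Complete.

(** * Bounded operators *)

Section LinearMaps.
Variables (S : pzRingType) (U V : lmodType S) (f : U -> V).
Hypothesis lf : linear f.

Let F : {linear U -> V} :=
  HB.pack f (GRing.isLinear.Build S U V _ f lf).

Lemma lin0 : f 0 = 0. Proof. exact: (linear0 F). Qed.
Lemma linD x y : f (x + y) = f x + f y. Proof. exact: (linearD F). Qed.
Lemma linB x y : f (x - y) = f x - f y. Proof. exact: (linearB F). Qed.
Lemma linZ c x : f (c *: x) = c *: f x. Proof. exact: (linearZ_LR F). Qed.
Lemma lin_sum (I : Type) (s : seq I) (P : pred I) (u : I -> U) :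
  f (\sum_(i <- s | P i) u i) = \sum_(i <- s | P i) f (u i).
Proof. exact: (linear_sum F). Qed.

End LinearMaps.

Section BoundedOperators.
Variable R : realType.
Implicit Types E H K : hilbertSpace R.

Lemma bounded_opP H K (T : H -> K) :
  bounded_op T <->
  linear T /\ exists2 M : R, 0 < M & forall x, rnorm (T x) <= M * rnorm x.
Proof.
split=> [[lT [M hM]]|[lT [M M0 hM]]]; split=> //; last first.
  by exists M%:C => x; rewrite rnorm_le.
(* The real part of [M] may be negative when [H] is zero; the maximum and the extra 1 make the bound
   positive. *)
exists (Num.max (complex.Re M) 0 + 1) => [|x].
  by rewrite ltr_wpDl // le_max lexx orbT.
have : rnorm (T x) <= complex.Re M * rnorm x.
  have := hM x; rewrite !rnormE lecE => /andP[_]; case: (M) => p q /=.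
  by rewrite mulr0 subr0.
move=> /le_trans; apply; rewrite ler_wpM2r ?rnorm_ge0 // ler_wpDr //.
by rewrite le_max lexx.
Qed.

Lemma bounded_lin H K (T : H -> K) : bounded_op T -> linear T.
Proof. by case. Qed.

Lemma bounded_bound H K (T : H -> K) : bounded_op T ->
  exists2 M : R, 0 < M & forall x, rnorm (T x) <= M * rnorm x.
Proof. by move=> /bounded_opP[]. Qed.

Lemma bounded_comp E H K (S : H -> K) (T : E -> H) :
  bounded_op S -> bounded_op T -> bounded_op (S \o T).
Proof.
move=> bS bT; have [M M0 hM] := bounded_bound bS.
have [N N0 hN] := bounded_bound bT.
apply/bounded_opP; split=> [c x y /=|].
  by rewrite (bounded_lin bT) (bounded_lin bS).
exists (M * N) => [|x /=]; first exact: mulr_gt0.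
by rewrite (le_trans (hM _)) // -mulrA ler_pM2l.
Qed.

Lemma bounded_id H : bounded_op (@id H).
Proof.
by apply/bounded_opP; split=> //; exists 1 => // x; rewrite mul1r.
Qed.

Lemma bounded_zero H K : bounded_op ((fun=> 0) : H -> K).
Proof.
apply/bounded_opP; split=> [c x y|]; first by rewrite scaler0 addr0.
by exists 1 => // x; rewrite rnorm0 mul1r rnorm_ge0.
Qed.

Lemma bounded_add H K (S T : H -> K) :
  bounded_op S -> bounded_op T -> bounded_op (S \+ T).
Proof.
move=> bS bT; have [M M0 hM] := bounded_bound bS.
have [N N0 hN] := bounded_bound bT.
apply/bounded_opP; split=> [c x y /=|].
  by rewrite (bounded_lin bT) (bounded_lin bS) scalerDr addrACA.
exists (M + N) => [|x /=]; first exact: addr_gt0.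
by rewrite (le_trans (rnormD _ _)) // mulrDl lerD.
Qed.

Lemma bounded_scale H K c (T : H -> K) :
  bounded_op T -> bounded_op (fun x => c *: T x).
Proof.
move=> bT; have [M M0 hM] := bounded_bound bT.
apply/bounded_opP; split=> [d x y /=|].
  by rewrite (bounded_lin bT) scalerDr !scalerA mulrC.
have c0 : 0 <= complex.Re `|c| by rewrite -ler0c RRe_real ?ger0_real.
exists (complex.Re `|c| * M + 1) => [|x].
  by rewrite ltr_wpDl // mulr_ge0 // ltW.
rewrite rnormZ mulrDl mul1r -mulrA ler_wpDr ?rnorm_ge0 //.
exact: ler_wpM2l.
Qed.

Lemma bounded_sum H K (I : Type) (s : seq I) (P : pred I) (T : I -> H -> K) :
  (forall i, P i -> bounded_op (T i)) ->
  bounded_op (fun x => \sum_(i <- s | P i) T i x).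
Proof.
move=> bT; elim: s => [|i s IH].
  by rewrite (_ : (fun _ => _) = fun=> 0) ?funeqE => [|x];
    [exact: bounded_zero|rewrite big_nil].
have [Pi|Pi] := boolP (P i).
  rewrite (_ : (fun _ => _) = T i \+ (fun x => \sum_(j <- s | P j) T j x)).
    by apply: bounded_add => //; exact: bT.
  by apply/funext => x /=; rewrite big_cons Pi.
rewrite (_ : (fun _ => _) = fun x => \sum_(j <- s | P j) T j x) //.
by apply/funext => x /=; rewrite big_cons (negbTE Pi).
Qed.

Lemma le0_eps (x c : R) : (forall eps, 0 < eps -> x <= c * eps) -> x <= 0.
Proof.
move=> h; rewrite leNgt; apply/negP => x0.
have c1 : 0 < `|c| + 1 by rewrite ltr_wpDl.
have c2 : 0 < 2 * (`|c| + 1) by rewrite mulr_gt0.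
have := h (x / (2 * (`|c| + 1))) (divr_gt0 x0 c2).
apply/negP; rewrite -ltNge mulrA ltr_pdivrMr // mulrC ltr_pM2l //.
by have := ler_norm c; have := normr_ge0 c; lra.
Qed.

Section Extension.
Variables (H K : hilbertSpace R) (G : set (H * K)) (M : R).
Hypothesis M0 : 0 < M.
Hypothesis G_lin : forall c p q, G p -> G q -> G (c *: p.1 + q.1, c *: p.2 + q.2).
Hypothesis G_bound : forall p, G p -> rnorm p.2 <= M * rnorm p.1.
Hypothesis G_dense : rdense (fst @` G).

(** The closure of the graph [G]. Linearity and the bound pass to it; the bound makes it
    single-valued, and completeness of [K] with density of the domain makes it total. *)
Let G' (x : H) (y : K) := forall eps, 0 < eps ->
  exists2 p, G p & rnorm (x - p.1) <= eps /\ rnorm (y - p.2) <= eps.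

Let G'_lin c x y x' y' : G' x y -> G' x' y' -> G' (c *: x + x') (c *: y + y').
Proof.
move=> Gxy Gxy' eps eps0.
have c0 : 0 <= complex.Re `|c| by rewrite -ler0c RRe_real ?ger0_real.
have c1 : 0 < complex.Re `|c| + 1 by rewrite ltr_wpDl.
pose d := eps / (complex.Re `|c| + 1).
have d0 : 0 < d by exact: divr_gt0.
have dE : eps = complex.Re `|c| * d + d by rewrite /d; field; rewrite gt_eqF.
have [p Gp [p1 p2]] := Gxy _ d0; have [q Gq [q1 q2]] := Gxy' _ d0.
exists (c *: p.1 + q.1, c *: p.2 + q.2); first exact: G_lin.
have E (L : hilbertSpace R) (u u' v v' : L) :
    c *: u + u' - (c *: v + v') = c *: (u - v) + (u' - v').
  by rewrite scalerBr opprD addrACA.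
by rewrite /= !E dE; split;
  rewrite (le_trans (rnormD _ _)) // lerD // rnormZ ler_wpM2l.
Qed.

Let G'_bound x y : G' x y -> rnorm y <= M * rnorm x.
Proof.
move=> Gxy; rewrite -subr_le0; apply: (@le0_eps _ (1 + M)) => eps eps0.
have [p Gp [p1 p2]] := Gxy _ eps0.
have h1 : rnorm y <= rnorm (y - p.2) + rnorm p.2.
  by have := rnormD (y - p.2) p.2; rewrite subrK.
have h2 : rnorm p.1 <= rnorm (x - p.1) + rnorm x.
  by have := rnormD (p.1 - x) x; rewrite subrK rnorm_distC.
have h3 : M * rnorm p.1 <= M * (eps + rnorm x) by rewrite ler_pM2l //; lra.
have := G_bound Gp; lra.
Qed.

Let G'_ex x : exists y, G' x y.
Proof.
have /choice[u hu] (n : nat) : exists p, G p /\ rnorm (x - p.1) <= n.+1%:R^-1.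
  by have [|_ [p Gp <-] hp] := @G_dense x n.+1%:R^-1; [|exists p].
have [|y hy] := @rnorm_complete R K (fun n => (u n).2).
  move=> eps eps0.
  have [|N hN] := @invS_le_eps R (eps / (2 * M)); first by rewrite divr_gt0 ?mulr_gt0.
  exists N => i j Ni Nj.
  have Gij : G ((-1) *: (u j).1 + (u i).1, (-1) *: (u j).2 + (u i).2).
    by apply: G_lin; apply: (hu _).1.
  have := G_bound Gij; rewrite /= !scaleN1r !(addrC (- _)) => /le_trans; apply.
  have := rnorm_distD x (u i).1 (u j).1; rewrite (rnorm_distC _ x).
  have := (hu i).2; have := (hu j).2; have := hN _ Ni; have := hN _ Nj.
  move=> h1 h2 h3 h4 h5; rewrite mulrC -ler_pdivlMr //.
  have -> : eps / M = eps / (2 * M) + eps / (2 * M) by field; rewrite gt_eqF.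
  by rewrite (le_trans h5) // lerD // ?(le_trans h4) ?(le_trans h3).
exists y => eps eps0.
have [N1 h1] := invS_le_eps eps0; have [N2 h2] := hy _ eps0.
exists (u (maxn N1 N2)); first exact: (hu _).1.
split; last by rewrite rnorm_distC h2 // leq_maxr.
by rewrite (le_trans (hu _).2) // h1 // leq_maxl.
Qed.

Lemma bounded_extension :
  exists T : H -> K, [/\ linear T, forall x, rnorm (T x) <= M * rnorm x
    & forall p, G p -> T p.1 = p.2].
Proof.
have /choice[T hT] := G'_ex.
have uniq_T x y : G' x y -> T x = y.
  move=> Gxy; apply/eqP; rewrite -subr_eq0; apply/eqP/rnorm_eq0/eqP.
  rewrite eq_le rnorm_ge0 andbT.
  have := G'_bound (G'_lin (-1) Gxy (hT x)).
  by rewrite !scaleN1r !(addrC (- _)) subrr rnorm0 mulr0.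
exists T; split=> [c x y|x|p Gp].
- by apply: uniq_T; apply: G'_lin.
- exact: G'_bound.
- by apply: uniq_T => eps eps0; exists p => //; rewrite !subrr !rnorm0 ltW.
Qed.

End Extension.

Lemma rnorm_sqr_sum_orth H (I : eqType) (s : seq I) (f : I -> H) :
  uniq s -> (forall i j, i != j -> rdot (f i) (f j) = 0) ->
  rnorm (\sum_(i <- s) f i) ^+ 2 = \sum_(i <- s) rnorm (f i) ^+ 2.
Proof.
move=> us fo; elim: s us => [|i s IH] /=; first by rewrite !big_nil rnorm0 expr0n.
move=> /andP[si us].
have f0 : rdot (f i) (\sum_(j <- s) f j) = 0.
  rewrite rdot_sumr big_seq big1 // => j sj.
  by apply: fo; apply: contraNneq si => ->.
by rewrite !big_cons rnorm_sqrD IH // f0 mulr0 addr0.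
Qed.

(** The source of the operators [W_i] and [X (x) W_s]. By Pythagoras on both sides a bound on each
    piece is a bound on all finite sums, which also makes the map [L s |-> L' s] well defined. *)
Lemma orthogonal_extension H K (V : lmodType R[i]) (I : eqType)
    (J : I -> V -> H) (J' : I -> V -> K) (M : R) :
  0 < M ->
  (forall i, linear (J i)) -> (forall i, linear (J' i)) ->
  (forall i j x y, i != j -> rdot (J i x) (J j y) = 0) ->
  (forall i j x y, i != j -> rdot (J' i x) (J' j y) = 0) ->
  (forall i x, rnorm (J' i x) <= M * rnorm (J i x)) ->
  rdense [set z | exists s : seq (V * I), z = \sum_(p <- s) J p.2 p.1] ->
  exists T : H -> K, [/\ linear T, forall x, rnorm (T x) <= M * rnorm x
    & forall i x, T (J i x) = J' i x].
Proof.
move=> M0 lJ lJ' oJ oJ' bJ dJ.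
pose L (s : seq (V * I)) := \sum_(p <- s) J p.2 p.1.
pose L' (s : seq (V * I)) := \sum_(p <- s) J' p.2 p.1.
(* A list may repeat an index; grouping equal indices makes the summands mutually orthogonal. *)
have collect (W : lmodType R[i]) (Q : I -> V -> W) s : (forall i, linear (Q i)) ->
    \sum_(p <- s) Q p.2 p.1 = \sum_(i <- undup [seq p.2 | p <- s])
      Q i (\sum_(p <- s | p.2 == i) p.1).
  move=> lQ; under [RHS]eq_bigr do rewrite (lin_sum (lQ _)) big_mkcond.
  rewrite exchange_big big_seq [RHS]big_seq; apply: eq_bigr => p sp.
  rewrite (bigD1_seq p.2) ?undup_uniq //=; last first.
    by rewrite mem_undup; apply/mapP; exists p.
  by rewrite eqxx big1 ?addr0 // => i; rewrite eq_sym => /negbTE ->.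
have [||||T [lT bT TG]] :=
    @bounded_extension H K [set (L s, L' s) | s in setT] M.
- by [].
- move=> c _ _ [s _ <-] [t _ <-] /=.
  exists ([seq (c *: p.1, p.2) | p <- s] ++ t) => //.
  rewrite /L /L' !big_cat !big_map /= !scaler_sumr.
  by congr (_ + _, _ + _); apply: eq_bigr => p _; rewrite linZ.
- move=> _ [s _ <-] /=; rewrite /L /L' !collect //.
  rewrite -(@ler_pXn2r _ 2) ?nnegrE ?mulr_ge0 ?rnorm_ge0 ?(ltW M0) //.
  rewrite exprMn rnorm_sqr_sum_orth ?undup_uniq //; last first.
    by move=> i j; exact: oJ'.
  rewrite rnorm_sqr_sum_orth ?undup_uniq //; last by move=> i j; exact: oJ.
  rewrite mulr_sumr ler_sum // => i _; rewrite -exprMn.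
  by rewrite ler_pXn2r ?nnegrE ?mulr_ge0 ?rnorm_ge0 ?(ltW M0).
- move=> z eps /(dJ z)[_ [s ->] hd]; exists (L s) => //.
  by exists (L s, L' s) => //; exists s.
exists T; split=> // i x.
have := TG (J i x, J' i x); apply; exists [:: (x, i)] => //.
by rewrite /L /L' !big_seq1.
Qed.

End BoundedOperators.

(** * Riesz representation and adjoints *)

Section Riesz.
Variable R : realType.
Implicit Types H K : hilbertSpace R.

(* The representing vector is the minimizer of [||x||^2 - 2 f x]: the
   parallelogram identity makes every minimizing sequence Cauchy. *)
Lemma real_riesz H (f : H -> R) (M : R) :
  (forall x y, f (x + y) = f x + f y) ->
  (forall (t : R) x, f (t%:C *: x) = t * f x) ->
  (forall x, f x <= M * rnorm x) ->
  exists l, forall x, f x = rdot x l.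
Proof.
move=> fD fZ fM.
pose J x := rnorm x ^+ 2 - 2 * f x.
have J_lb x : - M ^+ 2 <= J x.
  rewrite /J; have := fM x; have := sqr_ge0 (rnorm x - M); nra.
have hasJ : has_inf (range J).
  by split; [exists (J 0); exists 0|exists (- M ^+ 2) => _ [x _ <-]].
pose m := inf (range J).
have m_le x : m <= J x by apply: ge_inf; [exact: hasJ.2|exists x].
have /choice[u hu] (n : nat) : exists x, J x <= m + n.+1%:R^-1.
  have n0 : 0 < n.+1%:R^-1 :> R by [].
  have [_ [x _ <-] /ltW hx] := inf_adherent n0 hasJ.
  by exists x.
have parallelogram x y : rnorm (x - y) ^+ 2 <= 2 * (J x - m) + 2 * (J y - m).
  have := m_le ((2^-1)%:C *: (x + y)).
  rewrite /J fZ fD rnormZr exprMn real_normK ?num_real //.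
  by rewrite rnorm_sqrB rnorm_sqrD; lra.
have [|l hl] := @rnorm_complete R H u.
  move=> eps eps0.
  have [|N hN] := @invS_le_eps R (eps ^+ 2 / 4); first by rewrite divr_gt0 ?exprn_gt0.
  exists N => i j Ni Nj.
  rewrite -(@ler_pXn2r _ 2) ?nnegrE ?rnorm_ge0 ?(ltW eps0) //.
  have := parallelogram (u i) (u j); have := hu i; have := hu j.
  move: (hN _ Ni) (hN _ Nj); set a := i.+1%:R^-1; set b := j.+1%:R^-1; lra.
(* This is [J l <= J (l + v)], reached along the minimizing sequence: [J (u i + v) >= m] while
   [J (u i)] is close to [m]. *)
have variation v : 0 <= rnorm v ^+ 2 + 2 * (rdot v l - f v).
  rewrite -oppr_le0; apply: (@le0_eps _ _ (1 + 2 * rnorm v)) => eps eps0.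
  have [N1 h1] := invS_le_eps eps0; have [N2 h2] := hl _ eps0.
  set i := maxn N1 N2.
  have := h1 i (leq_maxl _ _); have := hu i; have := h2 i (leq_maxr _ _).
  have := m_le (u i + v); have := rdot_le v (u i - l).
  rewrite rdotDr rdotNr /J fD rnorm_sqrD (rdotC _ v) => h3 h4 h5 h6 h7.
  have : rnorm v * rnorm (u i - l) <= rnorm v * eps.
    by rewrite ler_wpM2l ?rnorm_ge0.
  move: h6 h7; set a := i.+1%:R^-1; lra.
exists l => v; apply/eqP; rewrite eq_sym -subr_eq0; apply/eqP.
set d := _ - _; pose q := rnorm v ^+ 2.
have q0 : 0 <= q by exact: sqr_ge0.
(* The optimal multiple of [v] would be [- d / q]; the denominator [q + 1] also serves for [v = 0]
   and still forces [d = 0]. *)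
have := variation ((- d / (q + 1))%:C *: v).
rewrite rnormZr exprMn real_normK ?num_real // fZ rdotZl -mulrBr -/d -/q.
have -> : (- d / (q + 1)) ^+ 2 * q + 2 * (- d / (q + 1) * d)
    = - (d / (q + 1)) ^+ 2 * (q + 2).
  by field; rewrite gt_eqF // ltr_wpDl.
move=> h; have : (d / (q + 1)) ^+ 2 <= 0 by nra.
rewrite le_eqVlt ltNge sqr_ge0 orbF sqrf_eq0 mulf_eq0 invr_eq0.
by rewrite (gt_eqF (ltr_wpDl q0 ltr01)) orbF => /eqP.
Qed.

Lemma bounded_adjoint H K (T : H -> K) : bounded_op T ->
  exists2 T' : K -> H, bounded_op T' &
    forall x z, dotp K (T x) z = dotp H x (T' z).
Proof.
move=> bT; have lT := bounded_lin bT; have [M M0 hM] := bounded_bound bT.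
have /choice[T' hT'] z : exists c, forall x, dotp K (T x) z = dotp H x c.
  have [|||c hc] := @real_riesz H (fun x => rdot (T x) z) (M * rnorm z).
  - by move=> x y; rewrite (linD lT) rdotDl.
  - by move=> t x; rewrite (linZ lT) rdotZl.
  - move=> x; rewrite (le_trans (rdot_le _ _)) // mulrAC.
    by rewrite ler_wpM2r ?rnorm_ge0.
  exists c => x; apply: rdot_dot => d; rewrite -(linZ lT); exact: hc.
exists T' => [|x z]; last exact: hT'.
apply/bounded_opP; split=> [c x y|].
  apply: dot_eq => z; rewrite dotC -hT' [RHS]dotC; congr Num.conj.
  by rewrite !dotDr !dotZr !hT'.
exists M => // z; have [->|z0] := eqVneq (rnorm (T' z)) 0.
  by rewrite mulr_ge0 ?rnorm_ge0 // ltW.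
have z1 : 0 < rnorm (T' z) by rewrite lt_neqAle eq_sym z0 rnorm_ge0.
rewrite -(ler_pM2l z1) -expr2 rnorm_sqr /rdot -hT' -/(rdot _ _).
rewrite (le_trans (rdot_le _ _)) // mulrCA mulrA.
by rewrite ler_wpM2r ?rnorm_ge0.
Qed.

End Riesz.

(** * Weights *)

Section WeightBounds.
Variables (R : realType) (n m : nat) (a : word n -> R).
Hypothesis a_ge0 : forall w, 0 <= a w.
Hypothesis a_gen : forall i, 0 < a [:: i].

(** The bound [N] on the factor lengths is kept apart from [w], so that it can grow by one when a
    letter is added. *)
Let fact_pred N (w : word n) j (g : j.-tuple (N.-bseq 'I_n)) :=
  (flatten [seq bseqval x | x <- g] == w)
    && [forall i : 'I_j, (1 <= size (tnth g i))%N].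

Let fact_sum N (w : word n) j : R :=
  \sum_(g : j.-tuple (N.-bseq 'I_n) | fact_pred w g) \prod_(i < j) a (tnth g i).

(** Starting at [j = 0] removes the case distinction: that term is 1 for the empty word and 0 for
    all others. *)
Let weightE w : weight m a w =
  \sum_(0 <= j < (size w).+1) fact_sum (size w) w j * 'C(j + m - 1, m - 1)%:R.
Proof.
have w0 N u : fact_sum N u 0 = (u == [::])%:R.
  rewrite /fact_sum (eq_bigl (fun=> u == [::])) => [|g]; last first.
    rewrite /fact_pred (_ : tval g = [::]) /=; last by case: g => [[]].
    by rewrite eq_sym andbC (_ : [forall _, _]) //; apply/forallP => [[]].
  under eq_bigr do rewrite big_ord0.
  by case: (u == [::]); rewrite ?big_pred0_eq // sumr_const card_tuple expn0.
case: w => [|i w]; first by rewrite big_nat1 w0 mul1r add0n binn.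
rewrite [RHS]big_nat_recl // w0 mul0r add0r [LHS]/= big_add1 /=.
by apply: eq_bigr => j _; rewrite mulr_suml.
Qed.

(** Putting [i] in front as a factor of its own maps the factorizations of [w] into [j] factors
    injectively to those of [i :: w] into [j + 1], and the binomial coefficient does not decrease.
    This gives positivity of the weights and the bound [a_i ^ (-1/2)] for [W_i]. *)
Lemma weight_cons i w : a [:: i] * weight m a w <= weight m a (i :: w).
Proof.
have fact_ge0 N u j : 0 <= fact_sum N u j.
  by apply: sumr_ge0 => g _; apply: prodr_ge0.
have step N j : a [:: i] * fact_sum N w j <= fact_sum N.+1 (i :: w) j.+1.
  pose h (g : j.-tuple (N.-bseq 'I_n)) : j.+1.-tuple (N.+1.-bseq 'I_n) :=
    cons_tuple (widen_bseq (ltn0Sn N) [bseq i])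
      (map_tuple (widen_bseq (leqnSn N)) g).
  have h_inj : injective h.
    move=> g g' /(congr1 val) [] /inj_map e; apply/val_inj/e.
    by move=> u v /(congr1 val) /= uv; apply/val_inj.
  have hS g k : tnth (h g) (lift ord0 k) = widen_bseq (leqnSn N) (tnth g k).
    by rewrite tnthS tnth_map.
  rewrite /fact_sum mulr_sumr.
  (* Factorizations outside the image of [h] contribute nonnegative terms, which are dropped. *)
  rewrite [leRHS](bigID (fun g => g \in h @: [set g | fact_pred w g]%SET)) /=.
  apply: ler_wpDr; first by apply: sumr_ge0 => g _; apply: prodr_ge0.
  rewrite (eq_bigl (fun g => g \in h @: [set g | fact_pred w g]%SET)); last first.
    move=> g; apply: andb_idl => /imsetP[g' + ->]; rewrite inE /fact_pred.
    move=> /andP[/eqP gw /forallP g1]; apply/andP; split.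
      by rewrite /= -map_comp /= -[X in _ == _ :: X]gw.
    apply/forallP => k; have [k' ->|->] := unliftP ord0 k; last by rewrite tnth0.
    by rewrite hS; exact: g1.
  rewrite big_imset; last by move=> x y _ _ /h_inj.
  rewrite [leRHS](eq_bigl (fun g => fact_pred w g)) => [|g]; last by rewrite inE.
  apply: ler_sum => g _; rewrite big_ord_recl tnth0 /=.
  by under [X in _ <= _ * X]eq_bigr do rewrite hS.
rewrite !weightE [leRHS]big_nat_recl // ler_wpDl ?mulr_ge0 //=.
rewrite mulr_sumr; apply: ler_sum => j _; rewrite mulrA ler_pM ?mulr_ge0 //.
by rewrite ler_nat leq_bin2l // leq_sub2r // addSn.
Qed.

Lemma weight_gt0 w : 0 < weight m a w.
Proof.
elim: w => [|i w IH]; first by rewrite /weight.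
by apply: lt_le_trans (weight_cons i w); rewrite mulr_gt0.
Qed.

End WeightBounds.

(** * Fejer means *)

Section FejerKernel.
Variable R : realType.

(** Subtraction is truncated: one of [i - j] and [j - i] is 0, and the whole numerator stops at 0.
    For [k = 0] the value is 0. *)
Definition fejer k i j : R := (k - (i - j) - (j - i))%:R / k%:R.

(** For fixed [l] these are the degrees from [l - k] to [l - 1]. Starting at [l = 1] gives low
    degrees their full share of [k] windows without negative indices. *)
Definition window k l i := (i < l <= i + k)%N.

Lemma window_count L k i : (i + k < L)%N -> (\sum_(l < L) window k l i = k)%N.
Proof.
move=> iL; rewrite -(big_mkord xpredT (fun l => window k l i : nat)).
rewrite (big_cat_nat (n := i.+1)) ?leq0n //=; last by lia.
rewrite (big_cat_nat (n := (i + k).+1) (p := L)) //=; last by lia.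
rewrite big_nat_cond big1 ?add0n => [|l]; last first.
  by rewrite /window; case: ltnP => //=; lia.
rewrite [X in (_ + X)%N]big_nat_cond [X in (_ + X)%N]big1 ?addn0 => [|l]; last first.
  by rewrite /window; case: (leqP l (i + k)) => //=; rewrite ?andbF //; lia.
rewrite big_nat_cond (eq_bigr (fun=> 1%N)) => [|l]; last first.
  by rewrite /window andbT ltnS => ->.
by rewrite -big_nat_cond sum_nat_const_nat muln1; lia.
Qed.

(* A Fejer mean is an average of compressions to windows of [k] consecutive
   degrees. *)
Lemma fejerE L k i j : (i + k < L)%N -> (j + k < L)%N ->
  fejer k i j = k%:R^-1 * \sum_(l < L) (window k l i && window k l j)%:R.
Proof.
move=> iL jL; rewrite /fejer mulrC -natr_sum; congr (_ * _%:R).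
wlog ij : i j iL jL / (i <= j)%N => [hw|].
  have [ij|/ltnW ij] := leqP i j; first exact: hw.
  by rewrite subnAC (hw j i) //; apply: eq_bigr => l _; rewrite andbC.
have [kij|kij] := leqP k (j - i).
  rewrite big1 => [|l _]; first by lia.
  by apply/eqP; rewrite eqb0 /window; apply/negP => /andP[/andP[? ?] /andP[? ?]]; lia.
(* For [i <= j] the common windows are those with [j < l <= i + k]. *)
transitivity (\sum_(l < L) window (k - (j - i)) l j)%N.
  by rewrite window_count; lia.
apply: eq_bigr => l _; congr nat_of_bool; rewrite /window.
by apply/idP/idP => [/andP[? ?]|/andP[/andP[? ?] /andP[? ?]]]; lia.
Qed.

Lemma fejer_sym k i j : fejer k i j = fejer k j i.
Proof. by rewrite /fejer subnAC. Qed.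

Lemma fejer_le1 k i j : `|fejer k i j - 1| <= 1.
Proof.
rewrite /fejer; have [->|k0] := eqVneq k 0; first by rewrite invr0 mulr0 sub0r normrN1.
rewrite ler_norml lerBrDr addNr divr_ge0 //= lerBlDr ler_wpDl //.
by rewrite ler_pdivrMr ?ltr0n ?lt0n // mul1r ler_nat -subnDA leq_subr.
Qed.

(** Gives uniform smallness on finitely many degrees as [k] grows; [fejer_le1] takes care of the
    remaining ones. *)
Lemma fejer_dist k i j : (0 < k)%N ->
  `|fejer k i j - 1| <= (i + j)%:R / k%:R.
Proof.
move=> k0; have kR : 0 < k%:R :> R by rewrite ltr0n.
rewrite ler_norml lerBlDr lerBrDl /fejer; apply/andP; split.
  rewrite -[X in X - _](@divff _ k%:R) ?gt_eqF // -mulrBl ler_pM2r ?invr_gt0 //.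
  by rewrite lerBlDr -natrD ler_nat; lia.
rewrite ler_wpDl ?divr_ge0 // ler_pdivrMr // mul1r ler_nat.
by rewrite -subnDA leq_subr.
Qed.

End FejerKernel.

(** * Hilbert sums of copies of [E], and Fejer means in coordinates *)

Section Coordinates.
Variables (R : realType) (E K : hilbertSpace R) (I : eqType) (J : I -> E -> K).
Hypothesis J_lin : forall i, linear (J i).
Hypothesis J_dot : forall i j x y,
  dotp K (J i x) (J j y) = (i == j)%:R * dotp E x y.
Hypothesis J_dense : rdense [set z | exists s : seq (E * I),
  z = \sum_(p <- s) J p.2 p.1].

Lemma rdot_J i j x y : rdot (J i x) (J j y) = if i == j then rdot x y else 0.
Proof. by rewrite /rdot J_dot; case: eqP => _; rewrite ?mul1r ?mul0r. Qed.

Lemma rnorm_J i x : rnorm (J i x) = rnorm x.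
Proof.
apply/eqP; rewrite -(@eqrXn2 _ 2) ?rnorm_ge0 //.
by rewrite !rnorm_sqr rdot_J eqxx.
Qed.

Lemma bounded_J i : bounded_op (J i).
Proof.
apply/bounded_opP; split=> //; exists 1 => // x.
by rewrite rnorm_J mul1r.
Qed.

(** The coordinate [c i] is the adjoint of the isometry [J i]. *)
Lemma coordinates : exists2 c : I -> K -> E, forall i, bounded_op (c i) &
  forall i z y, dotp K z (J i y) = dotp E (c i z) y.
Proof.
have /choice[c hc] i : exists ci, bounded_op ci /\
    forall y z, dotp K (J i y) z = dotp E y (ci z).
  by have [ci ? ?] := bounded_adjoint (bounded_J i); exists ci.
exists c => [i|i z y]; first by have [] := hc i.
by rewrite dotC (hc i).2 -dotC.
Qed.

Variable c : I -> K -> E.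
Hypothesis bounded_c : forall i, bounded_op (c i).
Hypothesis dot_c : forall i z y, dotp K z (J i y) = dotp E (c i z) y.

Lemma coord_J i j x : c i (J j x) = if i == j then x else 0.
Proof.
apply: dot_eq => y; rewrite -dot_c J_dot eq_sym.
by case: eqP => _; rewrite ?mul1r ?mul0r ?dot0l.
Qed.

Lemma rdot_coord i z y : rdot z (J i y) = rdot (c i z) y.
Proof. by rewrite /rdot dot_c. Qed.

Definition proj (s : seq I) (z : K) : K := \sum_(i <- s) J i (c i z).

Lemma projB s y z : proj s (y - z) = proj s y - proj s z.
Proof.
rewrite /proj -sumrB; apply: eq_bigr => i _.
by rewrite (linB (bounded_lin (bounded_c i))) (linB (J_lin i)).
Qed.

Lemma coord_proj s i z : uniq s -> c i (proj s z) = if i \in s then c i z else 0.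
Proof.
move=> us; rewrite (lin_sum (bounded_lin (bounded_c i))).
under eq_bigr do rewrite coord_J.
case: ifPn => si; last first.
  rewrite big_seq big1 // => j js; case: eqP => // ij.
  by rewrite -ij (negbTE si) in js.
rewrite (bigD1_seq i) //= eqxx big1 ?addr0 // => j.
by rewrite eq_sym => /negbTE ->.
Qed.

Lemma rnorm_proj s z : uniq s ->
  rnorm (proj s z) ^+ 2 = \sum_(i <- s) rnorm (c i z) ^+ 2.
Proof.
move=> us; rewrite rnorm_sqr_sum_orth // => [|i j /negbTE ij]; last first.
  by rewrite rdot_J ij.
by apply: eq_bigr => i _; rewrite rnorm_J.
Qed.

Lemma proj_le s z : uniq s -> rnorm (proj s z) <= rnorm z.
Proof.
move=> us; have := rdot_le (proj s z) z.
rewrite rdot_suml (eq_bigr (fun i => rnorm (c i z) ^+ 2)) => [|i _]; last first.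
  by rewrite rdotC rdot_coord rnorm_sqr.
rewrite -rnorm_proj // expr2.
have := rnorm_ge0 (proj s z); rewrite le_eqVlt => /orP[/eqP <- _|p0].
  exact: rnorm_ge0.
by rewrite ler_pM2l.
Qed.

Lemma proj_dense z eps : 0 < eps ->
  exists2 s, uniq s & rnorm (z - proj s z) <= eps.
Proof.
move=> eps0; have [|_ [t ->] ht] := @J_dense z (eps / 2); first by rewrite divr_gt0.
set d := \sum_(p <- t) _ in ht *.
(* With all indices of [d] included, [proj s] fixes [d]; being contractive, it at most doubles the
   error [eps / 2]. *)
exists (undup [seq p.2 | p <- t]); first exact: undup_uniq.
set s := undup _; have us : uniq s by exact: undup_uniq.
have dE : proj s d = d.
  transitivity (\sum_(p <- t) \sum_(i <- s) J i (c i (J p.2 p.1))).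
    rewrite exchange_big; apply: eq_bigr => i _.
    by rewrite (lin_sum (bounded_lin (bounded_c i))) (lin_sum (J_lin i)).
  rewrite big_seq [RHS]big_seq; apply: eq_bigr => p tp.
  rewrite (bigD1_seq p.2) //=; last by rewrite mem_undup; apply/mapP; exists p.
  rewrite coord_J eqxx big1 ?addr0 // => i /negbTE ip.
  by rewrite coord_J ip (lin0 (J_lin i)).
have -> : z - proj s z = (z - d) - proj s (z - d).
  by rewrite projB dE opprB addrA subrK.
rewrite (le_trans (rnormB _ _)) // (le_trans (lerD ht (proj_le _ us))) //.
by move: ht; lra.
Qed.

Lemma coord_le M x y : 0 <= M ->
  (forall i, rnorm (c i x) <= M * rnorm (c i y)) -> rnorm x <= M * rnorm y.
Proof.
move=> M0 hM; rewrite -subr_le0; apply: (@le0_eps _ _ 1) => eps eps0.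
have [s us hs] := proj_dense x eps0.
have : rnorm (proj s x) <= M * rnorm (proj s y).
  rewrite -(@ler_pXn2r _ 2) ?nnegrE ?mulr_ge0 ?rnorm_ge0 // exprMn !rnorm_proj //.
  rewrite mulr_sumr ler_sum // => i _; rewrite -exprMn.
  by rewrite ler_pXn2r ?nnegrE ?mulr_ge0 ?rnorm_ge0.
have : M * rnorm (proj s y) <= M * rnorm y by rewrite ler_wpM2l // proj_le.
have := rnormD (x - proj s x) (proj s x); rewrite subrK; lra.
Qed.

Variable len : I -> nat.

Definition fejer_mean k (T S : K -> K) := bounded_op S /\
  forall i j x, c i (S (J j x)) = (fejer R k (len i) (len j))%:C *: c i (T (J j x)).

Section FejerMeans.
Variables (T : K -> K) (M : R).
Hypotheses (lT : linear T) (M0 : 0 < M).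
Hypothesis bT : forall z, rnorm (T z) <= M * rnorm z.

(** The symmetric bound replaces [M * |x| * |y|] because squared norms add up over coordinates: each
    coordinate lies in [k] windows, so the sum over all windows is [k] times the total and cancels
    the factor [1 / k]. *)
Lemma fejer_mean_form k S s t y z : (0 < k)%N -> fejer_mean k T S ->
  uniq s -> uniq t ->
  rdot (S (proj s y)) (proj t z) <=
    M / 2 * (rnorm (proj s y) ^+ 2 + rnorm (proj t z) ^+ 2).
Proof.
move=> k0 [bS SE] us ut; have lS := bounded_lin bS.
have kR : 0 < k%:R :> R by rewrite ltr0n.
pose win l i := window k l (len i).
(* Large enough for every window that meets a degree of [s] or [t] to have its number below [L]. *)
pose L := (\sum_(i <- s) len i + \sum_(i <- t) len i + k).+1.
have leL r i : i \in r -> (len i <= \sum_(i <- r) len i)%N.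
  elim: r => // j r IH; rewrite inE big_cons => /orP[/eqP ->|/IH ir].
    exact: leq_addr.
  by rewrite (leq_trans ir) // leq_addl.
have win_sum (f : I -> R) r : (forall i, i \in r -> (len i + k < L)%N) ->
    \sum_(l < L) \sum_(i <- r | win l i) f i = k%:R * \sum_(i <- r) f i.
  move=> rL; rewrite mulr_sumr; under eq_bigr do rewrite big_mkcond.
  rewrite exchange_big big_seq [RHS]big_seq; apply: eq_bigr => i ir.
  rewrite -(@window_count L k (len i)) ?rL // natr_sum mulr_suml.
  by apply: eq_bigr => l _; rewrite /win; case: ifP => _; rewrite ?mul1r ?mul0r.
have sL i : i \in s -> (len i + k < L)%N.
  by move=> /(leL s) h; rewrite ltnS leq_add2r (leq_trans h) ?leq_addr.
have tL i : i \in t -> (len i + k < L)%N.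
  by move=> /(leL t) h; rewrite ltnS leq_add2r (leq_trans h) ?leq_addl.
pose A j i := rdot (T (J j (c j y))) (J i (c i z)).
have compress l :
    rdot (T (proj [seq j <- s | win l j] y)) (proj [seq i <- t | win l i] z) =
    \sum_(j <- s) \sum_(i <- t) (win l i && win l j)%:R * A j i.
  rewrite (lin_sum lT) rdot_suml big_filter big_mkcond; apply: eq_bigr => j _.
  case: ifP => _; last by rewrite big1 // => i _; rewrite andbF mul0r.
  rewrite rdot_sumr big_filter big_mkcond; apply: eq_bigr => i _.
  by rewrite andbT; case: ifP; rewrite ?mul1r ?mul0r.
have -> : rdot (S (proj s y)) (proj t z) = k%:R^-1 * \sum_(l < L)
    rdot (T (proj [seq j <- s | win l j] y)) (proj [seq i <- t | win l i] z).
  under [in RHS]eq_bigr do rewrite compress.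
  rewrite exchange_big mulr_sumr (lin_sum lS) rdot_suml big_seq [RHS]big_seq.
  apply: eq_bigr => j js; rewrite exchange_big mulr_sumr rdot_sumr.
  rewrite big_seq [RHS]big_seq; apply: eq_bigr => i it.
  rewrite rdot_coord SE rdotZl -rdot_coord -/(A j i) (fejerE _ (tL _ it) (sL _ js)).
  by rewrite -mulrA mulr_suml.
rewrite mulrC ler_pdivrMr //.
apply: (@le_trans _ _ (\sum_(l < L) M / 2 *
   (\sum_(j <- s | win l j) rnorm (c j y) ^+ 2 +
    \sum_(i <- t | win l i) rnorm (c i z) ^+ 2))).
  apply: ler_sum => l _; rewrite -!(big_filter _ (win l)) -!rnorm_proj ?filter_uniq //.
  set u := proj _ y; set v := proj _ z.
  have : rnorm (T u) * rnorm v <= M * rnorm u * rnorm v.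
    by rewrite ler_wpM2r ?rnorm_ge0.
  (* Arithmetic-geometric mean inequality, turning [M * |u| * |v|] into the symmetric bound. *)
  have : 0 <= M * (rnorm u - rnorm v) ^+ 2 by rewrite mulr_ge0 ?sqr_ge0 // ltW.
  have := rdot_le (T u) v; lra.
rewrite -mulr_sumr big_split /= !win_sum // -mulrDr !rnorm_proj //.
by rewrite [leRHS]mulrAC mulrA.
Qed.

Lemma fejer_mean_le k S z : (0 < k)%N -> fejer_mean k T S ->
  rnorm (S z) <= M * rnorm z.
Proof.
move=> k0 fS; have [bS _] := fS; have lS := bounded_lin bS.
(* The bound [B] may depend on [S]; it serves only to pass from finite projections to arbitrary
   vectors. *)
have [B B0 hB] := bounded_bound bS.
have form x y : rdot (S x) y <= M / 2 * (rnorm x ^+ 2 + rnorm y ^+ 2).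
  rewrite -subr_le0; apply: (@le0_eps _ _ (B * (rnorm x + rnorm y))) => eps eps0.
  have [s us hs] := proj_dense x eps0; have [t ut ht] := proj_dense y eps0.
  have h1 := fejer_mean_form x y k0 fS us ut.
  have h2 : rdot (S (x - proj s x)) y <= B * eps * rnorm y.
    rewrite (le_trans (rdot_le _ _)) // ler_wpM2r ?rnorm_ge0 //.
    by rewrite (le_trans (hB _)) // ler_pM2l.
  have h3 : rdot (S (proj s x)) (y - proj t y) <= B * rnorm x * eps.
    rewrite (le_trans (rdot_le _ _)) // ler_pM ?rnorm_ge0 //.
    by rewrite (le_trans (hB _)) // ler_pM2l // proj_le.
  have h4 : M / 2 * (rnorm (proj s x) ^+ 2 + rnorm (proj t y) ^+ 2) <=
      M / 2 * (rnorm x ^+ 2 + rnorm y ^+ 2).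
    rewrite ler_pM2l ?divr_gt0 // lerD // ler_pXn2r ?nnegrE ?rnorm_ge0 //;
    exact: proj_le.
  move: h2 h3; rewrite (linB lS) rdotDl rdotNl rdotDr rdotNr; lra.
(* For this second argument the symmetric bound reads [|S z|^2 / M <= M / 2 * (|z|^2 + |S z|^2 /
   M^2)], which is [|S z|^2 <= M^2 * |z|^2]. *)
have := form z ((M^-1)%:C *: S z).
rewrite rdotZr -rnorm_sqr rnormZr exprMn real_normK ?num_real // => h.
rewrite -(@ler_pXn2r _ 2) ?nnegrE ?mulr_ge0 ?rnorm_ge0 ?(ltW M0) // exprMn.
move: h; set p := rnorm _ ^+ 2; set q := rnorm _ ^+ 2 => h.
have := ler_wpM2l (ltW M0) h.
have -> : M * (M^-1 * p) = p by rewrite mulrA divff ?mul1r ?gt_eqF.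
have -> : M * (M / 2 * (q + M^-1 ^+ 2 * p)) = (M ^+ 2 * q + p) / 2.
  by field; rewrite gt_eqF.
lra.
Qed.

(** Convergence on each [J j x] extends to finite sums by linearity and to all [z] by the bound [M],
    which is uniform in [k]. The index [k0] does not depend on [S]. *)
Lemma fejer_mean_cvg z eps : 0 < eps -> exists k0, forall k S, (k0 < k)%N ->
  fejer_mean k T S -> rnorm (S z - T z) <= eps.
Proof.
have small (x : R) eps' : 0 < eps' -> exists k0, forall k, (k0 < k)%N ->
    x / k%:R <= eps'.
  move=> eps0; exists (Num.truncn (`|x| / eps')) => k hk.
  rewrite ler_pdivrMr ?ltr0n ?(leq_ltn_trans _ hk) // mulrC -ler_pdivrMr //.
  apply: (@le_trans _ _ (`|x| / eps')).
    by rewrite ler_wpM2r ?ler_norm // invr_ge0 ltW.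
  by apply/ltW/(lt_le_trans (truncnS_gt _)); rewrite ler_nat.
have elementary j x eps' : 0 < eps' -> exists k0, forall k S, (k0 < k)%N ->
    fejer_mean k T S -> rnorm (S (J j x) - T (J j x)) <= eps'.
  move=> eps0; set y := T (J j x).
  have e2 : 0 < eps' / 2 by rewrite divr_gt0.
  (* On the finitely many indices in [s] the Fejer factor tends to 1 uniformly; outside [s] the
     error is at most the tail of [y]. *)
  have [s us hs] := proj_dense y e2.
  pose L := (\sum_(i <- s) len i + len j)%N.
  have [k0 hk0] := small (L%:R * rnorm y) _ e2; exists k0 => k S k0k [bS SE].
  have kgt0 : (0 < k)%N by exact: leq_ltn_trans k0k.
  set u := S _ - y.
  have cu i : c i u = (fejer R k (len i) (len j) - 1)%:C *: c i y.
    by rewrite (linB (bounded_lin (bounded_c i))) SE rmorphB scalerBl scale1r.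
  clearbody u; have h1 : rnorm (proj s u) <= L%:R / k%:R * rnorm y.
    apply: coord_le => [|i]; first by rewrite divr_ge0.
    rewrite coord_proj //; case: ifP => si; last first.
      by rewrite rnorm0 mulr_ge0 ?divr_ge0 ?rnorm_ge0.
    rewrite cu rnormZr ler_wpM2r ?rnorm_ge0 // (le_trans (fejer_dist _ _ _ kgt0)) //.
    rewrite ler_wpM2r ?invr_ge0 // ler_nat leq_add2r.
    by rewrite (bigD1_seq i) // leq_addr.
  have h2 : rnorm (u - proj s u) <= 1 * rnorm (y - proj s y).
    apply: coord_le => // i; rewrite mul1r.
    rewrite !(linB (bounded_lin (bounded_c i))) !coord_proj //.
    case: ifP => _; first by rewrite !subrr !rnorm0.
    rewrite !subr0 cu rnormZr ler_piMl ?rnorm_ge0 //; exact: fejer_le1.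
  have h3 : L%:R / k%:R * rnorm y <= eps' / 2 by rewrite mulrAC; exact: hk0.
  have := rnormD (u - proj s u) (proj s u); rewrite subrK.
  by move: h1 h2 h3 hs; lra.
have finite (s : seq I) y eps' : 0 < eps' -> exists k0, forall k S, (k0 < k)%N ->
    fejer_mean k T S -> rnorm (S (proj s y) - T (proj s y)) <= eps'.
  elim: s eps' => [|i s IH] eps' eps0.
    exists 0%N => k S _ [bS _]; rewrite /proj big_nil (lin0 lT).
    by rewrite (lin0 (bounded_lin bS)) subrr rnorm0 ltW.
  have e2 : 0 < eps' / 2 by rewrite divr_gt0.
  have [k1 h1] := elementary i (c i y) _ e2; have [k2 h2] := IH _ e2.
  exists (maxn k1 k2) => k S; rewrite gtn_max => /andP[k1k k2k] fS.
  have [bS _] := fS; rewrite /proj big_cons (linD lT) (linD (bounded_lin bS)).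
  rewrite opprD addrACA (le_trans (rnormD _ _)) //.
  by rewrite (splitr eps') lerD //; [exact: (h1 k S)|exact: (h2 k S)].
(* The error is [2 * M * d + d]: the tail of [z] under [S] and under [T], and the finite part. *)
move=> eps0; pose d := eps / (2 * M + 1).
have M1 : 0 < 2 * M + 1 by rewrite addr_gt0 ?mulr_gt0.
have d0 : 0 < d by rewrite divr_gt0.
have [s us hs] := proj_dense z d0; have [k0 hk0] := finite s z _ d0.
exists k0 => k S k0k fS; have [bS _] := fS.
have h1 := hk0 _ _ k0k fS.
have h2 : rnorm (S (z - proj s z)) <= M * d.
  by rewrite (le_trans (fejer_mean_le _ (leq_ltn_trans _ k0k) fS)) // ler_pM2l.
have h3 : rnorm (T (z - proj s z)) <= M * d.
  by rewrite (le_trans (bT _)) // ler_pM2l.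
have -> : S z - T z = S (z - proj s z) - T (z - proj s z)
    + (S (proj s z) - T (proj s z)).
  by rewrite (linB lT) (linB (bounded_lin bS)) opprB addrACA subrK addrAC subrr sub0r.
have dE : eps = 2 * (M * d) + d by rewrite /d; field; rewrite gt_eqF.
rewrite (le_trans (rnormD _ _)) // dE lerD //.
by rewrite (le_trans (rnormB _ _)) // mulr_natl mulr2n lerD.
Qed.

End FejerMeans.
End Coordinates.

(** * Multi-Toeplitz operators *)

Section ToeplitzForms.
Variables (R : realType) (n m : nat) (a : word n -> R).
Hypothesis weight_pos : forall w, 0 < weight m a w.

(** For fixed [x] and [y] the operator relations become scalar linear relations between matrix
    coefficients. *)
Definition toeplitz_form (q : word n -> word n -> R[i]) :=
  (forall i w v, comparable_r w v ->
     (lambda m a (rcons w i) (rcons v i))%:C * q (rcons w i) (rcons v i)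
     = (lambda m a w v)%:C * q w v) /\
  (forall w v, ~~ comparable_r w v -> q w v = 0).

Lemma toeplitz_form0 : toeplitz_form (fun _ _ => 0).
Proof. by split=> // i w v _; rewrite !mulr0. Qed.

Lemma toeplitz_formD q q' : toeplitz_form q -> toeplitz_form q' ->
  toeplitz_form (fun w v => q w v + q' w v).
Proof.
move=> [qT q0] [qT' q0']; split=> [i w v wv|w v wv].
  by rewrite !mulrDr qT // qT'.
by rewrite q0 // q0' // addr0.
Qed.

Lemma toeplitz_formZ c q : toeplitz_form q -> toeplitz_form (fun w v => c * q w v).
Proof.
move=> [qT q0]; split=> [i w v wv|w v wv]; last by rewrite q0 // mulr0.
by rewrite !(mulrCA _ c) qT.
Qed.

Lemma toeplitz_form_sum (I : Type) (s : seq I) (q : I -> word n -> word n -> R[i]) :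
  (forall i, toeplitz_form (q i)) ->
  toeplitz_form (fun w v => \sum_(i <- s) q i w v).
Proof.
move=> qT; elim: s => [|i s IH].
  by rewrite (_ : (fun _ _ => _) = fun _ _ => 0); [exact: toeplitz_form0|
    apply/funext => w; apply/funext => v; rewrite big_nil].
rewrite (_ : (fun _ _ => _) = fun w v => q i w v + \sum_(i <- s) q i w v).
  exact: toeplitz_formD.
by apply/funext => w; apply/funext => v; rewrite big_cons.
Qed.

Lemma suffix_anti (w v : word n) : suffix v w -> suffix w v -> w = v.
Proof.
by move=> /suffixP[s ->] /size_suffix; case: s => // i s; rewrite size_cat /=; lia.
Qed.

Lemma lambda_sym w v : comparable_r w v -> lambda m a w v = lambda m a v w.
Proof.
rewrite /comparable_r /lambda; case: ifPn => [vw _|_ /= ->] //.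
by case: ifPn => // /(suffix_anti vw) ->.
Qed.

Lemma comparable_r_sym (w v : word n) : comparable_r w v = comparable_r v w.
Proof. exact: orbC. Qed.

Lemma suffix_rcons2 i (w v : word n) : suffix (rcons v i) (rcons w i) = suffix v w.
Proof.
apply/suffixP/suffixP => [[s eq_s]|[s ->]]; exists s; last by rewrite rcons_cat.
by move: eq_s; rewrite -rcons_cat => /rcons_inj[].
Qed.

Lemma toeplitz_form_adj q : toeplitz_form q ->
  toeplitz_form (fun w v => Num.conj (q v w)).
Proof.
move=> [qT q0]; split=> [i w v wv|w v wv]; last first.
  by rewrite q0 ?rmorph0 // comparable_r_sym.
have conjR (x : R) : x%:C = Num.conj x%:C :> R[i] by rewrite conj_Creal // complex_real.
rewrite conjR -rmorphM lambda_sym; last by rewrite /comparable_r !suffix_rcons2.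
rewrite qT; last by rewrite comparable_r_sym.
rewrite rmorphM; congr (_ * _).
by rewrite lambda_sym 1?comparable_r_sym // [LHS]conj_Creal // complex_real.
Qed.

Lemma norm_le_eps (z : R[i]) (C : R) :
  (forall eps, 0 < eps -> `|z| <= (C * eps)%:C) -> z = 0.
Proof.
move=> h; have zE : (complex.Re `|z|)%:C = `|z| by rewrite RRe_real // ger0_real.
apply/eqP; rewrite -normr_le0 -zE lecR; apply: (@le0_eps _ _ C) => eps /h.
by rewrite -zE lecR.
Qed.

(** Each relation involves at most two entries, so it is enough to approximate any two entries
    simultaneously; a WOT neighbourhood controls exactly such finite sets of entries. *)
Lemma toeplitz_form_lim q :
  (forall w v w' v' eps, 0 < eps -> exists2 q', toeplitz_form q' &
     `|q w v - q' w v| <= eps%:C /\ `|q w' v' - q' w' v'| <= eps%:C) ->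
  toeplitz_form q.
Proof.
move=> ql; split=> [i w v wv|w v wv]; last first.
  apply: (@norm_le_eps _ 1) => eps eps0; rewrite mul1r.
  by have [q' [_ q0] [+ _]] := ql w v w v _ eps0; rewrite q0 // subr0.
set l' := lambda m a _ _; set l := lambda m a _ _.
apply/eqP; rewrite -subr_eq0; apply/eqP.
apply: (@norm_le_eps _ (l' + l)) => eps eps0.
have [q' [qT _] [h1 h2]] := ql (rcons w i) (rcons v i) w v _ eps0.
have l'_ge0 : 0 <= l' by rewrite /l' /lambda; case: ifP => _; exact: sqrtr_ge0.
have l_ge0 : 0 <= l by rewrite /l /lambda; case: ifP => _; exact: sqrtr_ge0.
(* As [q'] satisfies the relation, the defect of [q] is that of [q - q']. *)
rewrite (_ : _ - _ = l'%:C * (q (rcons w i) (rcons v i) - q' (rcons w i) (rcons v i))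
   - l%:C * (q w v - q' w v)); last by rewrite !mulrBr qT // opprB addrA subrK.
rewrite (le_trans (ler_normB _ _)) // !normrM mulrDl rmorphD !rmorphM lerD //.
  by rewrite ger0_norm ?ler0c //; apply: ler_wpM2l => //; rewrite ler0c.
by rewrite ger0_norm ?ler0c //; apply: ler_wpM2l => //; rewrite ler0c.
Qed.

Lemma lambda_cat s v :
  lambda m a (s ++ v) v = Num.sqrt (weight m a (s ++ v) / weight m a v).
Proof. by rewrite /lambda suffix_suffix. Qed.

(** The product of [lambda] and [q] does not change when a letter is appended to both words, so the
    whole diagonal [w = s ++ v] is governed by its entry in the first column. *)
Lemma toeplitz_form_cat q s v : toeplitz_form q ->
  q (s ++ v) v = (Num.sqrt (weight m a v / weight m a (s ++ v)) *
                  Num.sqrt (weight m a s))%:C * q s [::].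
Proof.
move=> [qT _].
have inv : (lambda m a (s ++ v) v)%:C * q (s ++ v) v =
    (lambda m a s [::])%:C * q s [::].
  elim/last_ind: v => [|v i IH]; first by rewrite cats0.
  by rewrite -rcons_cat qT // /comparable_r suffix_suffix.
move: inv; rewrite lambda_cat /lambda suffix0s divr1 => inv.
rewrite rmorphM -mulrA -inv mulrA -rmorphM -sqrtrM ?divr_ge0 ?ltW //.
by rewrite mulrA mulfVK ?gt_eqF // divff ?gt_eqF // sqrtr1 mul1r.
Qed.

End ToeplitzForms.

(** * Weighted shifts and their tensor products with bounded operators *)

Section WeightedShifts.
Variables (R : realType) (n m : nat) (a : word n -> R).
Variables (E F K : hilbertSpace R) (e : word n -> F) (tens : {bilinear E -> F -> K}).
Hypothesis a_ge0 : forall w, 0 <= a w.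
Hypothesis a_gen : forall i, 0 < a [:: i].
Hypothesis e_basis : orthonormal_basis e.
Hypothesis tensE : hilbert_tensor tens.

Let b := weight m a.
Let b_gt0 w : 0 < b w. Proof. exact: weight_gt0. Qed.

Lemma rnorm_e w : rnorm (e w) = 1.
Proof.
apply/eqP; rewrite -(@eqrXn2 _ 2) ?rnorm_ge0 // rnorm_sqr /rdot e_basis.1 eqxx.
by rewrite expr1n.
Qed.

Lemma rdot_e0 w v c d : w != v -> rdot (c *: e w) (d *: e v) = 0.
Proof.
by move=> /negbTE wv; rewrite /rdot dotZl dotZr e_basis.1 wv !mulr0.
Qed.

Lemma e_dense : rdense [set z : F | exists s : seq (R[i] * word n),
  z = \sum_(p <- s) p.1 *: e p.2].
Proof. exact/dense_rdense/e_basis.2. Qed.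

Lemma bounded_ext_basis (H : hilbertSpace R) (S T : F -> H) :
  bounded_op S -> bounded_op T ->
  (forall w, S (e w) = T (e w)) -> S =1 T.
Proof.
move=> bS bT ST x; apply/eqP; rewrite -subr_eq0; apply/eqP/rnorm_eq0/eqP.
rewrite eq_le rnorm_ge0 andbT.
pose D z := S z + (-1) *: T z.
have bD : bounded_op D by exact: bounded_add bS (bounded_scale (-1) bT).
have DE : S x - T x = D x by rewrite /D scaleN1r.
have [M M0 hM] := bounded_bound bD; rewrite DE.
apply: (@le0_eps _ _ M) => eps /(e_dense x)[d [s dE] hs].
have D0 : D d = 0.
  rewrite dE (lin_sum (bounded_lin bD)) big1 // => p _.
  by rewrite (linZ (bounded_lin bD)) /D ST scaleN1r subrr scaler0.
have := hM (x - d); rewrite (linB (bounded_lin bD)) D0 subr0 => /le_trans; apply.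
by rewrite ler_pM2l.
Qed.

Lemma weighted_creationP i : bounded_op (weighted_creation m a e i) /\
  forall w, weighted_creation m a e i (e w) =
    (Num.sqrt (b w / b (i :: w)))%:C *: e (i :: w).
Proof.
rewrite /weighted_creation; set P := [set W | _].
(* Without existence [xget] would return the zero map; the operator is built from its action on the
   lines spanned by the [e w]. *)
suff : exists W, P W by exact: xgetPex.
have lin_scale (x : F) : linear (fun c : R[i]^o => c *: x).
  by move=> c y z; rewrite scalerDl scalerA.
have [|||||||T [lT bT TE]] := @orthogonal_extension R F F R[i]^o (word n)
    (fun w c => c *: e w)
    (fun w c => c *: ((Num.sqrt (b w / b (i :: w)))%:C *: e (i :: w)))
    (Num.sqrt (a [:: i])^-1).
- by rewrite sqrtr_gt0 invr_gt0.
- by move=> w; exact: lin_scale.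
- by move=> w; exact: lin_scale.
- by move=> w v c d wv; exact: rdot_e0.
- move=> w v c d wv; rewrite !scalerA; apply: rdot_e0.
  by rewrite eqseq_cons eqxx.
- move=> w c; rewrite rnormZ rnormZr rnormZ !rnorm_e !mulr1 mulrC.
  rewrite ler_wpM2r //; first by rewrite -ler0c RRe_real ?ger0_real.
  rewrite ger0_norm ?sqrtr_ge0 // ler_wsqrtr //.
  rewrite ler_pdivrMr // mulrC ler_pdivlMr // mulrC; exact: weight_cons.
- exact: e_dense.
exists T; split; first by apply/bounded_opP; split=> //;
  exists (Num.sqrt (a [:: i])^-1) => //; rewrite sqrtr_gt0 invr_gt0.
by move=> w; have := TE w 1; rewrite !scale1r.
Qed.

(** The weights of the intermediate words telescope. *)
Lemma creation_wordP s : bounded_op (creation_word m a e s) /\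
  forall w, creation_word m a e s (e w) =
    (Num.sqrt (b w / b (s ++ w)))%:C *: e (s ++ w).
Proof.
elim: s => [|i s [bs sE]]; first split=> [|w] /=.
- exact: bounded_id.
- by rewrite divff ?gt_eqF // sqrtr1 scale1r.
have [bi iE] := weighted_creationP i; split=> [|w /=]; first exact: bounded_comp.
rewrite sE (linZ (bounded_lin bi)) iE scalerA -rmorphM -sqrtrM ?divr_ge0 ?ltW //.
by rewrite mulrA mulfVK ?gt_eqF.
Qed.

Lemma rnorm_tens x u : rnorm (tens x u) = rnorm x * rnorm u.
Proof.
apply/eqP; rewrite -(@eqrXn2 _ 2) ?mulr_ge0 ?rnorm_ge0 // exprMn.
apply/eqP/complexI; rewrite !rnorm_sqr /rdot rmorphM.
by rewrite /= !RRe_real ?tensE.1 //; rewrite -?tensE.1 -dotpE realX ?ger0_real.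
Qed.

(** These are the embeddings [J] of the coordinate section: [K] is the Hilbert sum of the copies
    [E (x) e_w] of [E]. *)
Definition elem w x := tens x (e w).

Lemma elem_lin w : linear (elem w).
Proof. by move=> c x y; rewrite /elem linearDl linearZl_LR. Qed.

Lemma elem_dot i j x y :
  dotp K (elem i x) (elem j y) = (i == j)%:R * dotp E x y.
Proof. by rewrite /elem tensE.1 e_basis.1 mulrC. Qed.

Lemma tens_lin x : linear (tens x).
Proof. by move=> c u v; rewrite linearDr linearZr_LR. Qed.

Lemma bounded_tens x : bounded_op (tens x).
Proof.
apply/bounded_opP; split; first exact: tens_lin.
exists (rnorm x + 1) => [|u]; first by rewrite ltr_wpDl ?rnorm_ge0.
by rewrite rnorm_tens ler_wpM2r ?rnorm_ge0 ?lerDl.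
Qed.

Lemma elem_dense : rdense [set z | exists s : seq (E * word n),
  z = \sum_(p <- s) elem p.2 p.1].
Proof.
set D := [set z | _].
have elementary x u eps : 0 < eps ->
    exists2 d, D d & rnorm (tens x u - d) <= eps.
  move=> eps0; have x1 : 0 < rnorm x + 1 by rewrite ltr_wpDl ?rnorm_ge0.
  have [|_ [s ->] hs] := @e_dense u (eps / (rnorm x + 1)); first exact: divr_gt0.
  exists (\sum_(p <- s) tens x (p.1 *: e p.2)).
    exists [seq (p.1 *: x, p.2) | p <- s]; rewrite big_map; apply: eq_bigr => p _.
    by rewrite /elem linearZr_LR linearZl_LR.
  rewrite -(lin_sum (tens_lin x)) -(linB (tens_lin x)) rnorm_tens.
  rewrite (le_trans (ler_wpM2l (rnorm_ge0 x) hs)) // mulrA ler_pdivrMr //.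
  by rewrite mulrC ler_pM2l // lerDl.
have sums (s : seq (E * F)) eps : 0 < eps ->
    exists2 d, D d & rnorm (\sum_(p <- s) tens p.1 p.2 - d) <= eps.
  elim: s eps => [|p s IH] eps eps0.
    exists 0; first by exists [::]; rewrite big_nil.
    by rewrite big_nil subrr rnorm0 ltW.
  have e2 : 0 < eps / 2 by rewrite divr_gt0.
  have [d1 [s1 ->] h1] := elementary p.1 p.2 _ e2; have [d2 [s2 ->] h2] := IH _ e2.
  exists (\sum_(p <- s1) elem p.2 p.1 + \sum_(p <- s2) elem p.2 p.1).
    by exists (s1 ++ s2); rewrite big_cat.
  by rewrite big_cons opprD addrACA (le_trans (rnormD _ _)) // (splitr eps) lerD.
move=> z eps eps0; have e2 : 0 < eps / 2 by rewrite divr_gt0.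
have [_ [s ->] h1] := dense_rdense tensE.2 z e2.
have [d Dd h2] := sums s _ e2; exists d => //.
by rewrite (le_trans (rnorm_distD (\sum_(p <- s) tens p.1 p.2) _ _)) //
  (splitr eps) lerD.
Qed.

(** The operator is defined on the pieces [E (x) e_w]. Words [s ++ i] and [s ++ j] differ when [i]
    and [j] do, so the images remain orthogonal; boundedness in [u] extends the formula from the
    basis to all [u]. *)
Lemma tensor_creation (X : E -> E) s : bounded_op X ->
  exists2 T : K -> K, bounded_op T &
    forall x u, T (tens x u) = tens (X x) (creation_word m a e s u).
Proof.
move=> bX; have [N N0 hN] := bounded_bound bX; have lX := bounded_lin bX.
have [bs sE] := creation_wordP s; have [L L0 hL] := bounded_bound bs.
have [|||||||T [lT bT TE]] := @orthogonal_extension R K K E (word n) elem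
    (fun w x => tens (X x) (creation_word m a e s (e w))) (N * L).
- exact: mulr_gt0.
- exact: elem_lin.
- by move=> w c x y; rewrite lX linearDl linearZl_LR.
- by move=> i j x y /negbTE ij; rewrite /rdot elem_dot ij mul0r.
- move=> i j x y /negbTE ij; rewrite /rdot tensE.1 !sE dotZl dotZr e_basis.1.
  by rewrite eqseq_cat // eqxx /= ij !mulr0.
- move=> w x; rewrite rnorm_tens /elem rnorm_tens mulrACA.
  by rewrite ler_pM ?rnorm_ge0.
- exact: elem_dense.
have bT' : bounded_op T.
  by apply/bounded_opP; split=> //; exists (N * L) => //; exact: mulr_gt0.
exists T => // x; apply: bounded_ext_basis => [||w]; last exact: TE.
  exact: bounded_comp (bounded_tens x).
exact: (bounded_comp (bounded_tens (X x))).
Qed.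

End WeightedShifts.

Lemma norm_closure_sub (R : realType) (H K : hilbertSpace R) (A : set (H -> K)) T :
  bounded_op T -> A T -> norm_closure A T.
Proof.
move=> bT AT; split=> // eps eps0; exists T => // x.
by rewrite rnorm_le subrr rnorm0 mulr_ge0 ?rnorm_ge0 // ltW.
Qed.

Lemma eqseq_catr (T : eqType) (s t v : seq T) : (s ++ v == t ++ v) = (s == t).
Proof.
apply/eqP/eqP => [h|-> //]; have := congr1 size h; rewrite !size_cat => /addIn hs.
by move/eqP: h; rewrite eqseq_cat // eqxx andbT => /eqP.
Qed.

(** * Toeplitz relations for the domain algebra, and realization of Fejer means *)

Section ToeplitzOperators.
Variables (R : realType) (n m : nat) (a : word n -> R).
Variables (E F K : hilbertSpace R) (e : word n -> F) (tens : {bilinear E -> F -> K}).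
Hypothesis a_ge0 : forall w, 0 <= a w.
Hypothesis a_gen : forall i, 0 < a [:: i].
Hypothesis e_basis : orthonormal_basis e.
Hypothesis tensE : hilbert_tensor tens.

Let b := weight m a.
Let b_gt0 w : 0 < b w. Proof. exact: weight_gt0. Qed.

Local Notation W := (creation_word m a e).
Local Notation J := (elem e tens).
Local Notation A := (domain_algebra_tensor m a e tens).

Definition op_form (T : K -> K) x y : word n -> word n -> R[i] :=
  fun w v => dotp K (T (J v x)) (J w y).

(** Two norm closures are nested in the definition of the algebra: this applies on [F] with
    [f = g = e], then on [K] with elementary tensors. *)
Lemma toeplitz_form_norm_closure (H G : hilbertSpace R) (B : set (H -> G))
    (f : word n -> H) (g : word n -> G) (C D : R) :
  (forall v, rnorm (f v) <= C) -> (forall w, rnorm (g w) <= D) ->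
  (forall S, B S -> toeplitz_form m a (fun w v => dotp G (S (f v)) (g w))) ->
  forall T, norm_closure B T ->
    toeplitz_form m a (fun w v => dotp G (T (f v)) (g w)).
Proof.
move=> fC gD BT T [bT Tapp]; apply: toeplitz_form_lim => w v w' v' eps eps0.
have C0 : 0 <= C by rewrite (le_trans _ (fC [::])) ?rnorm_ge0.
have D0 : 0 <= D by rewrite (le_trans _ (gD [::])) ?rnorm_ge0.
have CD : 0 < C * D + 1 by rewrite ltr_wpDl ?mulr_ge0.
have [S BS hS] := Tapp _ (divr_gt0 eps0 CD).
exists (fun w v => dotp G (S (f v)) (g w)); first exact: BT.
suff h u t : `|dotp G (T (f u)) (g t) - dotp G (S (f u)) (g t)| <= eps%:C by split.
rewrite -dotNl -dotDl (le_trans (dot_le _ _)) // lecR.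
have := hS (f u); rewrite rnorm_le => h.
apply: (@le_trans _ _ (eps / (C * D + 1) * (C * D))); last first.
  by rewrite mulrAC ler_pdivrMr // ler_pM2l // lerDl.
rewrite mulrA ler_pM ?rnorm_ge0 // (le_trans h) // ler_wpM2l //.
by rewrite divr_ge0 // ltW.
Qed.

(** The product of [lambda] and the entry is 1 on the diagonal [w = s ++ v], entries elsewhere
    vanish, and appending a letter on the right preserves this diagonal. *)
Lemma creation_form s : toeplitz_form m a (fun w v => dotp F (W s (e v)) (e w)).
Proof.
have WE w v : dotp F (W s (e v)) (e w) =
    if s ++ v == w then (Num.sqrt (b v / b w))%:C else 0.
  have [_ ->] := creation_wordP m a_ge0 a_gen e_basis s.
  by rewrite dotZl e_basis.1; case: eqP => [->|_]; rewrite ?mulr1 ?mulr0.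
have cancel v : (lambda m a (s ++ v) v)%:C *
    (Num.sqrt (b v / b (s ++ v)))%:C = 1 :> R[i].
  rewrite lambda_cat -rmorphM -sqrtrM ?divr_ge0 ?ltW ?weight_gt0 // mulrA.
  by rewrite mulfVK ?gt_eqF // divff ?gt_eqF // sqrtr1.
split=> [i w v _|w v]; rewrite !WE.
  rewrite -rcons_cat eqseq_rcons eqxx andbT.
  case: eqP => [<-|_]; last by rewrite !mulr0.
  by rewrite rcons_cat !cancel.
by case: eqP => // <-; rewrite /comparable_r suffix_suffix.
Qed.

Lemma domain_algebra_form Y : domain_algebra m a e Y ->
  toeplitz_form m a (fun w v => dotp F (Y (e v)) (e w)).
Proof.
apply: (@toeplitz_form_norm_closure F F _ e e 1 1) => [v|w|_ [s ->]].
- by rewrite (rnorm_e e_basis).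
- by rewrite (rnorm_e e_basis).
rewrite (_ : (fun _ _ => _) = fun w v =>
    \sum_(p <- s) p.1 * dotp F (W p.2 (e v)) (e w)).
  by apply: toeplitz_form_sum => p; apply/toeplitz_formZ/creation_form.
apply/funext => w; apply/funext => v; rewrite dot_suml.
by apply: eq_bigr => p _; rewrite dotZl.
Qed.

Lemma algebra_form T : A T -> forall x y, toeplitz_form m a (op_form T x y).
Proof.
move=> AT x y.
have Jr w u : rnorm (J w u) <= rnorm u.
  by rewrite (rnorm_tens tensE) (rnorm_e e_basis) mulr1.
apply: toeplitz_form_norm_closure (Jr^~ x) (Jr^~ y) _ T AT => S.
move=> [_ [k [X [Y [_ YA SE]]]]].
rewrite (_ : (fun _ _ => _) = fun w v =>
    \sum_(j < k) dotp E (X j x) y * dotp F (Y j (e v)) (e w)).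
  by apply: toeplitz_form_sum => j; apply/toeplitz_formZ/domain_algebra_form.
apply/funext => w; apply/funext => v; rewrite SE dot_suml.
by apply: eq_bigr => j _; rewrite tensE.1.
Qed.

Lemma op_form_adj T T' x y : (forall u v, dotp K (T u) v = dotp K u (T' v)) ->
  op_form T' x y = fun w v => Num.conj (op_form T y x v w).
Proof.
by move=> TT'; apply/funext => w; apply/funext => v; rewrite /op_form TT' -dotC.
Qed.

Lemma op_sum_form S : op_sum (adjoints A) A S ->
  forall x y, toeplitz_form m a (op_form S x y).
Proof.
move=> [S1 [S2 [[_ [T AT TS1]] AS2 ->]]] x y.
rewrite (_ : op_form _ x y = fun w v => op_form S1 x y w v + op_form S2 x y w v).
  apply: toeplitz_formD; last exact: algebra_form.
  by rewrite (op_form_adj x y TS1); apply: toeplitz_form_adj; exact: algebra_form.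
by apply/funext => w; apply/funext => v; rewrite /op_form dotDl.
Qed.

Variable c : word n -> K -> E.
Hypothesis bounded_c : forall w, bounded_op (c w).
Hypothesis dot_c : forall w z y, dotp K z (J w y) = dotp E (c w z) y.

Lemma op_coefE T w v x : bounded_op T -> op_coef e tens T w v x = c w (T (J v x)).
Proof.
move=> bT; rewrite /op_coef.
set P := [set C | _]; have Pc : P (fun x => c w (T (J v x))).
  split=> [|y z]; last by rewrite -dot_c.
  apply: (@bounded_comp _ _ _ _ (c w)) => //; apply: bounded_comp => //.
  exact: (bounded_J (elem_lin e tens) (elem_dot e_basis tensE)).
have [_ h] := xgetPex (fun=> 0) (ex_intro _ _ Pc).
by apply: dot_eq => y; rewrite h -dot_c.
Qed.

Lemma multi_toeplitzP T : weighted_right_multi_toeplitz m a e tens T <->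
  bounded_op T /\ forall x y, toeplitz_form m a (op_form T x y).
Proof.
split=> [[bT TT T0]|[bT TT]]; split=> //.
- move=> x y; split=> [i w v wv|w v wv].
    by rewrite /op_form !dot_c -!op_coefE // -!dotZl TT.
  by rewrite /op_form dot_c -op_coefE // T0 // dot0l.
- move=> i w v wv x; apply: dot_eq => y; rewrite !dotZl !op_coefE // -!dot_c.
  by have [h _] := TT x y; exact: h.
- move=> w v wv x; apply: dot_eq => y; rewrite op_coefE // -dot_c dot0l.
  by have [_ h] := TT x y; exact: h.
Qed.

Lemma analytic_sum (X : word n -> E -> E) (s : seq (word n)) :
  (forall w, bounded_op (X w)) ->
  exists2 P, A P & forall x u, P (tens x u) = \sum_(w <- s) tens (X w x) (W w u).
Proof.
move=> bX.
have /choice[T hT] w : exists T, bounded_op T /\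
    forall x u, T (tens x u) = tens (X w x) (W w u).
  by have [T ? ?] := tensor_creation m a_ge0 a_gen e_basis tensE w (bX w); exists T.
have PE x u : \sum_(w <- s) T w (tens x u) = \sum_(w <- s) tens (X w x) (W w u).
  by apply: eq_bigr => w _; rewrite (hT w).2.
exists (fun z => \sum_(w <- s) T w z) => //.
have bP : bounded_op (fun z => \sum_(w <- s) T w z).
  by apply: bounded_sum => w _; have [] := hT w.
apply: norm_closure_sub => //; split=> //.
exists (size s), (fun j => X (nth [::] s j)), (fun j => W (nth [::] s j)).
split=> [//|j|x u]; last by rewrite PE (big_nth [::]) big_mkord.
have [bW _] := creation_wordP m a_ge0 a_gen e_basis (nth [::] s j).
apply: norm_closure_sub => //; exists [:: (1, nth [::] s j)].
by apply/funext => z; rewrite big_seq1 scale1r.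
Qed.

(* The Toeplitz relations make the block entries of [T] on the diagonal
   [w = s ++ v] those of [sqrt b_s C_{s,1} (x) W_s]. *)
Lemma analytic_part T k (p : pred nat) : bounded_op T ->
  (forall x y, toeplitz_form m a (op_form T x y)) ->
  exists2 P, A P & forall w v x, c w (P (J v x)) =
    (if suffix v w && p (size w - size v)%N
     then fejer R k (size w) (size v) else 0)%:C *: c w (T (J v x)).
Proof.
move=> bT TT.
(* The factor [sqrt (b s)] compensates the weight in [W_s e_1 = b_s ^ (-1/2) e_s]. *)
pose X s x := (fejer R k (size s) 0 * Num.sqrt (b s))%:C *: c s (T (J [::] x)).
have bX s : bounded_op (X s).
  apply: bounded_scale; apply: (@bounded_comp _ _ _ _ (c s)) => //.
  apply: bounded_comp => //.
  exact: (bounded_J (elem_lin e tens) (elem_dot e_basis tensE)).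
(* Words longer than [k] have Fejer factor 0, so a finite list is enough. *)
pose l := [seq val u | u <- enum {: k.-bseq 'I_n} & p (size (val u))].
have ul : uniq l.
  rewrite map_inj_uniq; last exact: val_inj.
  by apply: filter_uniq; exact: enum_uniq.
have mem_l s : (s \in l) = (size s <= k)%N && p (size s).
  apply/mapP/andP => [[u + ->]|[sk ps]].
    by rewrite mem_filter => /andP[? _]; split=> //; exact: size_bseq.
  by exists (Bseq sk) => //; rewrite mem_filter ps mem_enum.
have [P AP PE] := analytic_sum l bX; exists P => // w v x.
apply: dot_eq => y; rewrite -dot_c dotZl -dot_c /elem PE dot_suml.
under eq_bigr => s _.
  rewrite tensE.1 (creation_wordP m a_ge0 a_gen e_basis s).2.
  rewrite [dotp F _ _]dotZl e_basis.1.
  over.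
have [vw|vw] /= := boolP (suffix v w); last first.
  rewrite mul0r big1 // => s _; case: eqP => [sv|_]; last by rewrite !mulr0.
  by rewrite -sv suffix_suffix in vw.
move: vw => /suffixP[s0 ->]; rewrite size_cat addnK.
(* The factor depends on the difference of lengths only, hence is constant along the diagonal of
   [s0]. *)
have fE : fejer R k (size s0 + size v) (size v) = fejer R k (size s0) 0.
  by rewrite /fejer; congr (_%:R / _); lia.
have [s0l|s0l] := boolP (s0 \in l).
  rewrite (bigD1_seq s0) //= eqxx mulr1 big1 ?addr0 => [|s /negbTE ss0]; last first.
    by rewrite eqseq_catr ss0 !mulr0.
  move: s0l; rewrite mem_l => /andP[_ ->].
  rewrite -[dotp K _ _]/(op_form T x y (s0 ++ v) v).
  rewrite (toeplitz_form_cat _ _ _ (TT x y)); last exact: weight_gt0.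
  rewrite /op_form dot_c /X dotZl fE !rmorphM.
  ring.
rewrite big_seq big1 => [|s sl]; last first.
  by rewrite eqseq_catr; case: eqP => [ss0|_]; rewrite ?mulr0 // -ss0 sl in s0l *.
move: s0l; rewrite mem_l negb_and -ltnNge fE.
move=> /orP[ks|/negbTE ->]; last by rewrite mul0r.
rewrite (_ : fejer R k (size s0) 0 = 0) ?if_same ?mul0r //.
by rewrite /fejer sub0n !subn0 (eqP (ltnW ks)) mul0r.
Qed.

Lemma fejer_mean_exists T k : bounded_op T ->
  (forall x y, toeplitz_form m a (op_form T x y)) ->
  exists2 S, op_sum (adjoints A) A S & fejer_mean J c size k T S.
Proof.
move=> bT TT; have [T' bT' adjT] := bounded_adjoint bT.
have TT' x y : toeplitz_form m a (op_form T' x y).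
  by rewrite (op_form_adj x y adjT); exact/toeplitz_form_adj/TT.
(* The entries with [w = v] go into [P]; the predicate [0 < d] keeps them out of [Q], so that they
   are counted once. *)
have [P AP PE] := analytic_part k predT bT TT.
have [Q AQ QE] := analytic_part k (fun d => 0 < d)%N bT' TT'.
have [bP bQ] : bounded_op P /\ bounded_op Q by split; [case: AP|case: AQ].
have [Q' bQ' adjQ] := bounded_adjoint bQ.
exists (Q' \+ P); first by exists Q', P; split=> //; split=> //; exists Q.
split=> [|w v x /=]; first exact: bounded_add.
apply: dot_eq => y; rewrite -dot_c dotDl dotZl !dot_c PE dotZl -!dot_c andbT.
have -> : dotp K (Q' (J v x)) (J w y) =
    (if suffix w v && (0 < size v - size w)%N
     then fejer R k (size w) (size v) else 0)%:C * dotp K (T (J v x)) (J w y).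
  rewrite dotC -adjQ dot_c QE dotZl -dot_c rmorphM [X in X * _]conj_Creal; last first.
    by rewrite complex_real.
  by rewrite fejer_sym; congr (_ * _); rewrite adjT [RHS]dotC.
have [vw|vw] /= := boolP (suffix v w).
  case: ifP => [/andP[wv]|_]; last by rewrite mul0r add0r.
  by rewrite (suffix_anti vw wv) subnn.
rewrite mul0r addr0; have [wv|wv] /= := boolP (suffix w v).
  case: ltnP => //; rewrite leqn0 subn_eq0 => vw'.
  move: vw; have /suffixP[[|i s] vE] := wv; first by rewrite vE suffix_refl.
  by move: vw'; rewrite vE size_cat /=; lia.
have [_ T0] := TT x y.
by rewrite -/(op_form T x y w v) T0 ?mulr0 // /comparable_r negb_or vw wv.
Qed.

End ToeplitzOperators.

(** * Operator topologies *)

Lemma ptws_continuous (X I : topologicalType) (V : uniformType) (f : X -> I -> V) :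
  (forall i, continuous (f^~ i)) -> continuous (f : X -> {ptws I -> V}).
Proof. by move=> cf x; apply/pointwise_cvgP => i; exact: cf. Qed.

Lemma ptws_comp_continuous (I V V' : topologicalType) (i : I) (g : V -> V') :
  continuous g -> continuous (fun f : {ptws I -> V} => g (f i)).
Proof.
move=> cg f; apply: (@continuous_comp {ptws I -> V} V V' (fun f => f i) g).
  exact: (@proj_continuous I (fun=> V) i).
exact: cg.
Qed.

Lemma initial_comp_continuous (X : choiceType) (Y V : topologicalType)
    (f : X -> Y) (g : Y -> V) :
  continuous g -> continuous (fun x : initial_topology f => g (f x)).
Proof.
move=> cg x; apply: (@continuous_comp (initial_topology f) Y V f g).
  exact: initial_continuous.
exact: cg.
Qed.

Section OperatorTopologies.
Variables (R : realType) (H : hilbertSpace R).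

Lemma dot_continuous (y : H) : continuous (fun z => dotp H z y : R[i]^o).
Proof.
move=> z0; apply/cvgrPdist_le => _ /gt0_real_complex[eps eps0 ->].
have y1 : 0 < rnorm y + 1 by rewrite ltr_wpDl ?rnorm_ge0.
have d0 : (0 : R[i]) < (eps / (rnorm y + 1))%:C by rewrite ltcR divr_gt0.
near=> z; rewrite -dotNl -dotDl (le_trans (dot_le _ _)) // lecR.
have : rnorm (z0 - z) <= eps / (rnorm y + 1).
  rewrite -lecR -rnormE; near: z; apply: cvgr_dist_le => //; exact: cvg_id.
rewrite ler_pdivlMr // => /(le_trans _); apply.
by rewrite ler_wpM2l ?rnorm_ge0 // lerDl.
Unshelve. all: by end_near. Qed.

Lemma sot_closure_cvg (A : set (H -> H)) (T : H -> H) (S : nat -> H -> H) :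
  bounded_op T -> (forall k, A (S k)) ->
  (forall z eps, 0 < eps -> exists k0, forall k, (k0 < k)%N ->
     rnorm (S k z - T z) <= eps) ->
  sot_closure A T.
Proof.
move=> bT AS ST; split=> // B nB.
have /(_ B nB) [k0 _ hk0] : {ptws, S @ \oo --> T}.
  apply/pointwise_cvgP => z; apply/cvgrPdist_le => _ /gt0_real_complex[eps eps0 ->].
  have [k0 hk0] := ST z eps eps0; exists k0.+1 => // k k0k.
  by rewrite /= distrC rnormE lecR; exact: hk0.
by exists (S k0); split; [exact: AS|apply: hk0 => /=].
Qed.

(** Matrix coefficients are continuous for pointwise convergence, hence so is the identity into the
    initial topology that they define. *)
Lemma sot_closure_sub_wot (A : set (H -> H)) : sot_closure A `<=` wot_closure A.
Proof.
move=> T [bT cT]; split=> // B nB; apply: cT.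
have cont : continuous
    (@matrix_coefs R H : {ptws H -> H} -> {ptws (H * H)%type -> R[i]^o}).
  apply: ptws_continuous => -[x y].
  exact: (@ptws_comp_continuous H H R[i]^o x _ (@dot_continuous y)).
have := @continuous_comp_initial (H -> H) {ptws H -> H} _ (@matrix_coefs R H) id cont.
by move=> /(_ T B nB).
Qed.

(** Two coefficients at once, as [toeplitz_form_lim] requires. *)
Lemma wot_closure_approx (A : set (H -> H)) T x y x' y' (eps : R) :
  wot_closure A T -> 0 < eps -> exists2 S, A S &
    `|dotp H (T x) y - dotp H (S x) y| <= eps%:C /\
    `|dotp H (T x') y' - dotp H (S x') y'| <= eps%:C.
Proof.
move=> [bT cT] eps0.
have near_coef u v : \forall S \near (T : initial_topology (@matrix_coefs R H)),
    `|dotp H (T u) v - dotp H (S u) v| <= eps%:C.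
  have ce : continuous (fun S : initial_topology (@matrix_coefs R H) =>
      matrix_coefs S (u, v)).
    exact: (@initial_comp_continuous _ _ _ (@matrix_coefs R H) _
      (@ptws_comp_continuous (H * H)%type R[i]^o R[i]^o (u, v) id (fun z => cvg_id))).
  by have /cvgrPdist_le := ce T; apply; rewrite ltcR.
have [S [AS [h1 h2]]] := cT _ (filterI (near_coef x y) (near_coef x' y')).
by exists S.
Qed.

End OperatorTopologies.

Theorem corollary2p4 (R : realType) (n m : nat) (a : word n -> R)
  (E F K : hilbertSpace R) (e : word n -> F) (tens : {bilinear E -> F -> K}) :
  (1 <= n)%N -> (1 <= m)%N ->
  positive_regular_free_holomorphic a ->
  separable E ->
  orthonormal_basis e ->
  hilbert_tensor tens ->
  let A := domain_algebra_tensor m a e tens in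
  weighted_right_multi_toeplitz m a e tens
    = wot_closure (op_sum (adjoints A) A)
  /\ wot_closure (op_sum (adjoints A) A)
    = sot_closure (op_sum (adjoints A) A).
Proof.
move=> _ _ [a_ge0 _ a_gen _] _ e_basis tensE A.
have J_lin := elem_lin e tens; have J_dot := elem_dot e_basis tensE.
have [c bounded_c dot_c] := coordinates J_lin J_dot.
have toeplitzP := multi_toeplitzP m a e_basis tensE bounded_c dot_c.
(* The inclusions form a cycle: multi-Toeplitz operators lie in the SOT closure, that in the WOT
   closure, and that among the multi-Toeplitz operators. *)
have MT_sot : weighted_right_multi_toeplitz m a e tens `<=`
    sot_closure (op_sum (adjoints A) A).
  move=> T /toeplitzP[bT TT]; have [M M0 hM] := bounded_bound bT.
  have /choice[S hS] k : exists S, op_sum (adjoints A) A S /\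
      fejer_mean (elem e tens) c size k T S.
    have [S ? ?] := fejer_mean_exists a_ge0 a_gen e_basis tensE bounded_c dot_c k bT TT.
    by exists S.
  apply: (sot_closure_cvg (S := S)) => // [k|z eps eps0]; first by have [] := hS k.
  have [k0 hk0] := fejer_mean_cvg J_lin J_dot (elem_dense e_basis tensE)
    bounded_c dot_c size (bounded_lin bT) M0 hM z eps0.
  by exists k0 => k k0k; apply: hk0 k0k _; have [] := hS k.
have wot_MT : wot_closure (op_sum (adjoints A) A) `<=`
    weighted_right_multi_toeplitz m a e tens.
  move=> T wT; apply/toeplitzP; split=> [|x y]; first by have [] := wT.
  apply: toeplitz_form_lim => w v w' v' eps eps0.
  have [S AS hS] := wot_closure_approx (elem e tens v x) (elem e tens w y)
    (elem e tens v' x) (elem e tens w' y) wT eps0.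
  exists (op_form e tens S x y) => //.
  exact: (op_sum_form a_ge0 a_gen e_basis tensE AS).
have sot_wot := @sot_closure_sub_wot R K (op_sum (adjoints A) A).
split; apply/seteqP; split=> //.
  by apply: subset_trans sot_wot.
by apply: subset_trans MT_sot.
Qed.
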